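(* Let $H$ and $K$ be complex infinite-dimensional separable Hilbert spaces, and let $A\in B(H)$, $B\in B(K)$. Then for each $\sigma_{*}\in\{\sigma_{l},\sigma_{aw}\}$, $$\bigcap_{C\in \Phi(K,H)}\sigma_{*}(M_{C})=\Big(\bigcap_{C\in B(K,H)}\sigma_{*}(M_{C})\Big)\cup \{\lambda\in \mathbb{C}: B-\lambda \text{ is compact}\}.$$
   Context: $B(H,K)$ is the set of bounded linear operators from $H$ to $K$, and $B(H)=B(H,H)$. For $T\in B(H,K)$, $N(T)$ and $R(T)$ are its kernel and range, $\alpha(T)=\dim N(T)$ and $\beta(T)=\dim (K/R(T))$, with values in $\{0,1,2,\dots\}\cup\{\infty\}$. $T$ is upper semi-Fredholm if $R(T)$ is closed and $\alpha(T)<\infty$; lower semi-Fredholm if $\beta(T)<\infty$; semi-Fredholm if it is either, in which case $\mathrm{ind}(T)=\alpha(T)-\beta(T)\in\mathbb{Z}\cup\{\pm\infty\}$; Fredholm if it is semi-Fredholm with $\alpha(T)<\infty$ and $\beta(T)<\infty$. $\Phi(K,H)$ denotes the set of Fredholm operators from $K$ to $H$. An upper semi-Weyl operator is an upper semi-Fredholm operator with $\mathrm{ind}\le 0$. For an operator $T$ on a Hilbert space: $\sigma_l(T)$ and $\sigma_{aw}(T)$ are the sets of $\lambda\in\mathbb{C}$ such that $T-\lambda I$ is not left invertible, respectively not upper semi-Weyl. $T-\lambda$ means $T-\lambda I$. For $C\in B(K,H)$, $M_C=\begin{pmatrix}A&C\\0&B\end{pmatrix}\in B(H\oplus K)$,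 i.e. $M_C(x,y)=(Ax+Cy,By)$. *)

(* Defs.v *)
From HB Require Import structures.
From mathcomp Require Import all_boot all_order all_algebra.
From mathcomp Require Import complex.
From mathcomp Require Import all_classical all_reals all_analysis.

Set Implicit Arguments.
Unset Strict Implicit.
Unset Printing Implicit Defensive.

Import Order.TTheory GRing.Theory Num.Theory.
Import numFieldNormedType.Exports.

Local Open Scope classical_set_scope.
Local Open Scope ring_scope.
Local Open Scope complex_scope.

HB.mixin Record CompleteNormedModule_isHilbert (R : realType) H
    & CompleteNormedModule R[i] H := {
  hdot : {dot H for @Num.conj R[i]} ;
  hdotE : forall x : H, hdot x x = `|x| ^+ 2
}.

#[short(type="hilbertType")]
HB.structure Definition Hilbert (R : realType) :=
  {H of CompleteNormedModule R[i] H & CompleteNormedModule_isHilbert R H}.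

Definition separable_space (T : topologicalType) :=
  exists D : set T, countable D /\ dense D.

Section Dimension.
Variables (F : fieldType) (V : lmodType F).
Implicit Types U W : set V.

(* For linear subspaces W `<=` U: the classes of the b i form a basis of the
   quotient U / W. *)
Definition basis_mod U W n (b : 'I_n -> V) :=
  (forall i, U (b i)) /\
  forall v, U v ->
    exists! c : 'rV[F]_n, W (v - \sum_(i < n) c ord0 i *: b i).

(* dim (U / W), equal to +oo when U / W has no finite basis. *)
Definition dim_mod U W : \bar int :=
  xget +oo%E
    [set (n%:Z)%:E | n in [set n : nat | exists b : 'I_n -> V, basis_mod U W b]].

Definition infinite_dimensional := dim_mod [set: V] [set 0] = +oo%E.

End Dimension.
Arguments infinite_dimensional {F} V.

Definition bounded_op (R : realType) (H K : normedModType R[i])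
    (T : {linear H -> K}) :=
  exists M : R, forall x, `|T x| <= M%:C * `|x|.

Definition bounded_ops (R : realType) (H K : normedModType R[i]) :
  set {linear H -> K} := [set T | bounded_op T].
Arguments bounded_ops {R} H K.

Section Fredholm.
Variables (R : realType) (H K : normedModType R[i]).
Implicit Type T : {linear H -> K}.

Definition alpha T := dim_mod (T @^-1` [set 0]) [set 0].
Definition beta T := dim_mod [set: K] (range T).

Definition upper_semi_fredholm T := closed (range T) /\ (alpha T < +oo)%E.
Definition lower_semi_fredholm T := (beta T < +oo)%E.
Definition semi_fredholm T := upper_semi_fredholm T \/ lower_semi_fredholm T.

(* Only meaningful when T is semi-Fredholm: [+oo - +oo] is [-oo] in [\bar int]. *)
Definition ind T : \bar int := (alpha T - beta T)%E.

Definition fredholm T :=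
  [/\ semi_fredholm T, (alpha T < +oo)%E & (beta T < +oo)%E].
Definition upper_semi_weyl T := upper_semi_fredholm T /\ (ind T <= 0)%E.

Definition left_invertible T :=
  exists S : {linear K -> H}, bounded_op S /\ cancel T S.

Definition compact_op T :=
  forall E : set H, bounded_set E -> precompact (T @` E).

Definition Phi : set {linear H -> K} :=
  [set T | bounded_ops H K T /\ fredholm T].

End Fredholm.
Arguments Phi {R} H K.

Section Spectra.
Variables (R : realType) (H : normedModType R[i]).
Implicit Type T : {linear H -> H}.

Definition sub_scalar T (l : R[i]) : {linear H -> H} := T \- l \*: idfun.

Definition sigma_l T : set R[i] := [set l | ~ left_invertible (sub_scalar T l)].
Definition sigma_aw T : set R[i] := [set l | ~ upper_semi_weyl (sub_scalar T l)].

End Spectra.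
Arguments sigma_l {R H} T.
Arguments sigma_aw {R H} T.

(* The library norm of H * K is the maximum norm. It is equivalent to the norm
   of the Hilbert direct sum, so both spaces have the same bounded operators,
   the same closed sets and hence the same spectra. *)
Lemma prod_norm_hilbert (R : realType) (H K : hilbertType R) (z : H * K) :
  `|z| ^+ 2 <= hdot z.1 z.1 + hdot z.2 z.2 <= 2 * `|z| ^+ 2.
Proof.
rewrite !hdotE; have n1 := normr_ge0 z.1; have n2 := normr_ge0 z.2.
have [le12|lt21] := real_leP (normr_real z.1) (normr_real z.2).
  have -> : `|z| = `|z.2| by rewrite prod_normE max_r.
  by rewrite lerDr exprn_ge0 //= mulr_natl mulr2n lerD2r lerXn2r.
have -> : `|z| = `|z.1| by rewrite prod_normE max_l ?ltW.
by rewrite lerDl exprn_ge0 //= mulr_natl mulr2n lerD2l lerXn2r // ltW.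
Qed.

Section BlockOperator.
Variables (R : realType) (H K : normedModType R[i]).
Variables (A : {linear H -> H}) (B : {linear K -> K}) (C : {linear K -> H}).

Definition block_op (z : H * K) : H * K := (A z.1 + C z.2, B z.2).

Fact block_op_linear : linear block_op.
Proof.
move=> a x y; rewrite /block_op /= !linearP; congr pair => //=.
by rewrite scalerDr addrACA.
Qed.

HB.instance Definition _ :=
  GRing.isLinear.Build R[i] (H * K)%type (H * K)%type _ block_op block_op_linear.

End BlockOperator.

(* Main.v *)
Require Import Defs.
From HB Require Import structures.
From mathcomp Require Import all_boot all_order all_algebra.
From mathcomp Require Import complex ring lra.
From mathcomp Require Import all_classical all_reals all_analysis.

(** Replacing [A] and [B] by [A - l] and [B - l], one has to show, for each of
    the two properties (left invertible, upper semi-Weyl), that [M_C] has it for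
    some Fredholm [C] if and only if [M_C] has it for some bounded [C] and [B] is
    not compact. Each property makes [M_C] upper semi-Fredholm, that is, of
    closed range and finite dimensional kernel.

    - If [B] is compact and [C] is Fredholm then [M_C] is not upper
      semi-Fredholm ([fredholm_compact_not_usf]). On the infinite dimensional
      space of the [(x, y)] with [A x + C y = 0], [M_C] is
      [(x, y) |-> (0, B y)]. The open mapping theorem lifts an orthonormal
      sequence of vectors [B y] to a bounded sequence of vectors [y], which
      compactness forbids.

    - If [M_C0] is upper semi-Fredholm then [A] has closed range and finite
      dimensional kernel ([block_usf_left]).

    - If moreover the range of [A] has finite codimension, then [C] is taken of
      the form [C0 + A D]. The operator [M_C] is then [M_C0] composed with an
      invertible operator and keeps its properties, while a factorization
      through [A] ([douglas]) allows [D] to be chosen so that [C] is a finite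
      rank perturbation of an isomorphism ([finite_corank_completion]).

    - If the range of [A] has infinite codimension and [B] is not compact, there
      is an infinite dimensional closed subspace [L] on which [B] is bounded
      below, with [B L] of infinite codimension and the complement of [L]
      infinite dimensional ([noncompact_splitting]). All the closed subspaces in
      sight are isomorphic by separability, so some invertible [C] carries [L]
      onto the range of [A] and the complement of [L] onto the complement of
      that range. The system [A x + C y = h], [B y = k] can then be solved one
      component at a time, which gives the kernel, the range and a left inverse
      of [M_C] ([infinite_corank_completion]).

    The subspace [L] is the closed span of an orthonormal sequence with
    orthogonal images, obtained by choosing vectors in the kernels of finitely
    many functionals ([noncompact_sequence]). Orthogonal
    projections, partial isometries and the inverse of [B] on [L] are all
    operators of the form x |-> sum_n b_n <x, e_n> f_n
    ([fourier_multiplier]). *)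

Import Order.TTheory GRing.Theory Num.Theory.
Import numFieldNormedType.Exports.

Local Open Scope classical_set_scope.
Local Open Scope ring_scope.
Local Open Scope complex_scope.

Set Implicit Arguments.
Unset Strict Implicit.
Unset Printing Implicit Defensive.

(** * Real-valued norms and sequential topology *)

(** The order of [R[i]] is partial; real-valued norms make linear arithmetic
    available. *)
Definition nm {R : realType} {V : normedZmodType R[i]} (x : V) : R :=
  complex.Re `|x|.

Section RealNorm.
Variable R : realType.

Section Zmod.
Variable V : normedZmodType R[i].
Implicit Types x y z : V.

Lemma nmE x : `|x| = (nm x)%:C.
Proof. by rewrite /nm RRe_real. Qed.

Lemma nm_ge0 x : 0 <= nm x.
Proof. by rewrite -lecR -nmE normr_ge0. Qed.

Lemma nmD x y : nm (x + y) <= nm x + nm y.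
Proof. by rewrite -lecR rmorphD /= -!nmE ler_normD. Qed.

Lemma nmN x : nm (- x) = nm x.
Proof. by rewrite /nm normrN. Qed.

Lemma nmB x y : nm (x - y) <= nm x + nm y.
Proof. by rewrite -(nmN y) nmD. Qed.

Lemma nmC x y : nm (x - y) = nm (y - x).
Proof. by rewrite -nmN opprB. Qed.

Lemma nm_tri z x y : nm (x - y) <= nm (x - z) + nm (z - y).
Proof. by rewrite (le_trans _ (nmD _ _)) // addrA subrK. Qed.

Lemma nm0 : nm (0 : V) = 0.
Proof. by rewrite /nm normr0. Qed.

Lemma nm_eq0 x : nm x = 0 -> x = 0.
Proof. by move=> h; apply: normr0_eq0; rewrite nmE h. Qed.

Lemma nm_gt0 x : x != 0 -> 0 < nm x.
Proof.
by move=> x0; rewrite lt_neqAle nm_ge0 andbT; apply: contra x0 => /eqP/esym/nm_eq0->.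
Qed.
End Zmod.

Lemma nmM (a b : R[i]) : nm (a * b) = nm a * nm b.
Proof. by apply: complexI; rewrite rmorphM /= -!nmE normrM. Qed.

Lemma nm_real (r : R) : nm r%:C = `|r|.
Proof. by rewrite /nm normc_def /= expr0n addr0 sqrtr_sqr. Qed.

Lemma nmZ (V : normedModType R[i]) (a : R[i]) (x : V) : nm (a *: x) = nm a * nm x.
Proof. by apply: complexI; rewrite rmorphM /= -!nmE normrZ. Qed.

Lemma nm_pos_eq0 (V : normedZmodType R[i]) (x : V) :
  (forall e : R, 0 < e -> nm x < e) -> x = 0.
Proof.
move=> h; apply/eqP; apply/negPn/negP => /nm_gt0 /h; by rewrite ltxx.
Qed.

Lemma gt0_complexE (e : R[i]) : 0 < e -> exists2 r : R, 0 < r & e = r%:C.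
Proof.
case: e => a b; rewrite ltcE /= => /andP[/eqP -> a0]; by exists a.
Qed.

Lemma ball_nmP (V : normedModType R[i]) (x y : V) (e : R) :
  ball x e%:C y <-> nm (x - y) < e.
Proof. by rewrite -ball_normE /= nmE ltcR. Qed.

Lemma closure_epsP (V : normedModType R[i]) (A : set V) x :
  closure A x <-> forall e : R, 0 < e -> exists2 y, A y & nm (x - y) < e.
Proof.
split.
  move=> cA e e0; have /cA [y [Ay]] : nbhs x (ball x e%:C).
    by apply: nbhsx_ballx; rewrite ltcR.
  by move=> /ball_nmP h; exists y.
move=> h B /nbhs_ballP [e /= /gt0_complexE [r r0 ->] sB].
by have [y Ay /ball_nmP/sB By] := h _ r0; exists y.
Qed.

Lemma closed_epsP (V : normedModType R[i]) (A : set V) :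
  closed A <->
  forall x, (forall e : R, 0 < e -> exists2 y, A y & nm (x - y) < e) -> A x.
Proof.
split; first by move=> cA x /closure_epsP/cA.
by move=> h x /closure_epsP/h.
Qed.

Definition seq_lim (V : normedModType R[i]) (u : nat -> V) (l : V) :=
  forall e : R, 0 < e -> exists N, forall n, (N <= n)%N -> nm (l - u n) < e.

Definition seq_cauchy (V : normedModType R[i]) (u : nat -> V) :=
  forall e : R, 0 < e ->
    exists N, forall m n, (N <= m)%N -> (N <= n)%N -> nm (u m - u n) < e.

(** Stated through sequences because this form passes to products: the open
    mapping theorem is applied on the product of two Hilbert spaces. *)
Definition seq_complete (V : normedModType R[i]) :=
  forall u : nat -> V, seq_cauchy u -> exists l, seq_lim u l.

Lemma complete_seq (V : completeNormedModType R[i]) : seq_complete V.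
Proof.
move=> u cu; have /cauchy_cvg /cvg_ex [l ul] : cauchy (u @ \oo).
  apply: cauchy_exP => _ /gt0_complexE [r r0 ->]; have [N hN] := cu _ r0.
  by exists (u N); exists N => // n /= Nn; apply/ball_nmP/hN.
exists l => e e0.
have : nbhs l (ball l e%:C) by apply: nbhsx_ballx; rewrite ltcR.
move=> /ul [N _ hN]; exists N => n Nn.
by have /ball_nmP := hN n Nn.
Qed.

Lemma prod_nm (U V : normedModType R[i]) (z : U * V) :
  [/\ nm z.1 <= nm z, nm z.2 <= nm z & nm z <= nm z.1 + nm z.2].
Proof.
rewrite -!lecR rmorphD /= -!nmE.
have [h|/ltW h] := real_leP (normr_real z.1) (normr_real z.2).
  have -> : `|z| = `|z.2| by rewrite prod_normE max_r.
  by rewrite h lexx lerDr normr_ge0.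
have -> : `|z| = `|z.1| by rewrite prod_normE max_l.
by rewrite h lexx lerDl normr_ge0.
Qed.

Lemma complete_prod (U V : normedModType R[i]) :
  seq_complete U -> seq_complete V -> seq_complete (U * V)%type.
Proof.
move=> cU cV u cu.
have [e e0|l1 h1] := cU (fst \o u).
  have [N hN] := cu e e0; exists N => m n Nm Nn.
  by have [+ _ _] := prod_nm (u m - u n); move=> /le_lt_trans; apply; exact: hN.
have [e e0|l2 h2] := cV (snd \o u).
  have [N hN] := cu e e0; exists N => m n Nm Nn.
  by have [_ + _] := prod_nm (u m - u n); move=> /le_lt_trans; apply; exact: hN.
exists (l1, l2) => e e0.
have e20 : 0 < e / 2 by lra.
have [N1 k1] := h1 _ e20; have [N2 k2] := h2 _ e20.
exists (maxn N1 N2) => n; rewrite geq_max => /andP[n1 n2].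
have [_ _ /le_lt_trans] := prod_nm ((l1, l2) - u n); apply.
have := k1 n n1; have := k2 n n2; rewrite /=; lra.
Qed.

Lemma seq_lim_uniq (V : normedModType R[i]) (u : nat -> V) l l' :
  seq_lim u l -> seq_lim u l' -> l = l'.
Proof.
move=> h h'; apply/eqP; rewrite -subr_eq0; apply/eqP/nm_pos_eq0 => e e0.
have e20 : 0 < e / 2 by lra.
have [N k] := h _ e20; have [N' k'] := h' _ e20.
have := k (maxn N N') (leq_maxl _ _); have := k' (maxn N N') (leq_maxr _ _).
have := nm_tri (u (maxn N N')) l l'.
rewrite (nmC (u _) l'); lra.
Qed.

Lemma bounded_opP (H K : normedModType R[i]) (T : {linear H -> K}) :
  bounded_op T <-> exists2 M : R, 0 < M & forall x, nm (T x) <= M * nm x.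
Proof.
split=> [[M hM]|[M M0 hM]].
  exists (`|M| + 1) => [|x]; first by rewrite ltr_wpDl.
  have := hM x; rewrite !nmE -rmorphM lecR => /le_trans; apply.
  by apply: ler_wpM2r; [exact: nm_ge0|have := ler_norm M; lra].
by exists M => x; rewrite !nmE -rmorphM lecR.
Qed.

Lemma bounded_setP (V : normedModType R[i]) (A : set V) :
  bounded_set A <-> exists M : R, forall x, A x -> nm x <= M.
Proof.
split.
  move=> /pinfty_ex_gt0 [M M0 hM]; have [r _ Mr] := gt0_complexE M0.
  by exists r => x /hM /=; rewrite nmE Mr lecR.
case=> M hM; exists (M%:C); split; first by apply/complex_realP; exists M.
move=> y My x /hM xM /=; apply: le_trans (ltW My).
by rewrite nmE lecR.
Qed.

Definition has_net (V : normedModType R[i]) (A : set V) (e : R) :=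
  exists s : seq V, forall x, A x -> exists2 y, y \in s & nm (y - x) < e.

(** An ultrafilter on the closure contains a ball of each finite net, hence is
    Cauchy, and completeness makes it converge. *)
Lemma net_precompact (V : completeNormedModType R[i]) (A : set V) :
  (forall e, 0 < e -> has_net A e) -> precompact A.
Proof.
move=> hA; rewrite precompactE compact_ultra => F FU FA.
have /cauchy_cvg /cvg_ex [l Fl] : cauchy F.
  apply: cauchy_exP => _ /gt0_complexE [r r0 ->].
  have [s hs] : has_net A (r / 2) by apply: hA; lra.
  have {}hs : forall x, closure A x -> exists2 y, y \in s & nm (y - x) < r.
    move=> x /closure_epsP /(_ (r / 2)) [|z Az xz]; first by lra.
    have [y ys yz] := hs _ Az; exists y => //.
    have := nm_tri z y x; rewrite (nmC z x); lra.
  have: F [set x | exists2 y, y \in s & ball y r%:C x].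
    by apply: filterS FA => x /hs [y ys /ball_nmP yx]; exists y.
  elim: s {hs} => [|y s IH] Fs; first by have [x []] := filter_ex Fs.
  have [Fy|Fy] := in_ultra_setVsetC (ball y r%:C) FU; first by exists y.
  apply: IH; apply: filterS (filterI Fs Fy) => x [[z]].
  by rewrite inE => /predU1P[->|zs] zx // _; exists z.
exists l; split => //; apply: (@closed_cvg _ _ F _ id) => //.
exact: closed_closure.
Qed.

(** The sequence has a cluster point in the compact closure, and two of its
    terms are close to that point. *)
Lemma precompact_pair (V : normedModType R[i]) (A : set V) (u : nat -> V) e :
  precompact A -> (forall n, A (u n)) -> 0 < e ->
  exists m n, m != n /\ nm (u m - u n) < e.
Proof.
rewrite precompactE => cA uA e0.
have e20 : 0 < e / 2 by lra.
have [|l [_ cl]] := cA (u @ \oo).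
  by exists 0%N => // n _; apply: subset_closure.
have nl : nbhs l (ball l (e / 2)%:C) by apply: nbhsx_ballx; rewrite ltcR.
have near_l N : exists2 n, (N <= n)%N & nm (l - u n) < e / 2.
  have [|x [[n /= Nn <-] /ball_nmP lx]] := cl (u @` [set n | (N <= n)%N]) _ _ nl.
    by exists N => // n Nn; exists n.
  by exists n.
have [m _ lm] := near_l 0%N; have [n mn ln] := near_l m.+1.
exists m, n; split; first by rewrite neq_ltn mn.
have := nm_tri l (u m) (u n); rewrite (nmC _ l); lra.
Qed.
End RealNorm.

(** * Finite dimensional quotients *)

Section FiniteDimension.
Variable F : fieldType.

Definition subspace_set (V : lmodType F) (W : set V) :=
  W 0 /\ forall a x y, W x -> W y -> W (a *: x + y).

Section Subspace.
Variables (V : lmodType F) (W : set V) (sW : subspace_set W).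

Lemma sub0 : W 0. Proof. exact: sW.1. Qed.
Lemma subZD a x y : W x -> W y -> W (a *: x + y). Proof. exact: sW.2. Qed.
Lemma subD x y : W x -> W y -> W (x + y).
Proof. by move=> Wx Wy; rewrite -[x]scale1r; apply: subZD. Qed.
Lemma subZ a x : W x -> W (a *: x).
Proof. by move=> Wx; rewrite -[_ *: _]addr0; apply: subZD => //; exact: sub0. Qed.
Lemma subN x : W x -> W (- x).
Proof. by rewrite -scaleN1r; exact: subZ. Qed.
Lemma subB x y : W x -> W y -> W (x - y).
Proof. by move=> Wx /subN; exact: subD. Qed.
Lemma subZV a x : a != 0 -> W (a *: x) -> W x.
Proof. by move=> a0 /(subZ a^-1); rewrite scalerA mulVf // scale1r. Qed.
End Subspace.

(** [W] plus the linear span of [s]; peeling off one generator at a time avoids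
    indexed coefficients. *)
Fixpoint in_span (V : lmodType F) (W : set V) (s : seq V) : set V :=
  if s is b :: s' then [set v | exists c, in_span W s' (v - c *: b)] else W.

(** The generators are not required to lie in [U], so that the property passes
    to subsets of [U] without any argument. *)
Definition fdim (V : lmodType F) (U W : set V) :=
  exists s, forall v, U v -> in_span W s v.

Section InSpan.
Variables (V : lmodType F).
Implicit Types U W X : set V.

Lemma in_spanS W X s : W `<=` X -> in_span W s `<=` in_span X s.
Proof. by move=> WX; elim: s => [//|b s IH] v /= [c /IH h]; exists c. Qed.

Lemma in_span_cat W s t : in_span W (s ++ t) = in_span (in_span W t) s.
Proof.
elim: s => [//|b s IH] /=; apply/seteqP; split => v /= [c];
  by rewrite ?IH => h; exists c; rewrite ?IH.
Qed.

Lemma in_span_subspace W s : subspace_set W -> subspace_set (in_span W s).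
Proof.
move=> sW; elim: s => [//|b s [IH0 IH]] /=; split.
  by exists 0; rewrite scale0r subr0.
move=> a x y [c xc] [d yd]; exists (a * c + d).
have := IH a _ _ xc yd; congr (in_span _ _ _).
by rewrite scalerBr scalerDl scalerA opprD addrACA.
Qed.

Lemma in_span_shift W X s v w : subspace_set X -> W `<=` X -> X w ->
  in_span W s (v - w) -> in_span X s v.
Proof.
move=> sX WX Xw /(in_spanS WX) h; have sS := in_span_subspace s sX.
rewrite -(subrK w v); apply: subD => //.
by elim: s {h sS} => [//|b s IH] /=; exists 0; rewrite scale0r subr0.
Qed.

Lemma fdimS U U' W W' : U' `<=` U -> W `<=` W' -> fdim U W -> fdim U' W'.
Proof. by move=> UU WW [s hs]; exists s => v /UU /hs; exact: in_spanS. Qed.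

Lemma fdim_trans U W X : fdim U W -> fdim W X -> fdim U X.
Proof.
move=> [s hs] [t ht]; exists (s ++ t) => v /hs; rewrite in_span_cat.
exact: in_spanS.
Qed.

Lemma in_span_sum W I (r : seq I) (b : I -> V) (c : I -> F) v :
  W (v - \sum_(i <- r) c i *: b i) -> in_span W [seq b i | i <- r] v.
Proof.
elim: r v => [|i r IH] v /=; first by rewrite big_nil subr0.
by rewrite big_cons opprD addrA => /IH; exists (c i).
Qed.

(** Induction on the generating list: the part [U0] of [U] spanned by the tail
    has a basis, and if [U0] is not [U] then any vector of [U] outside [U0]
    completes that basis, since its coefficient on the head is invertible. *)
Lemma fdim_basis U W : subspace_set U -> subspace_set W -> W `<=` U ->
  fdim U W -> exists n (b : 'I_n -> V), basis_mod U W b.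
Proof.
move=> sU sW WU [s]; elim: s U sU WU => [|b s IH] U sU WU hs.
  exists 0%N, (fun=> 0); split=> [[]//|v Uv]; exists 0; split.
    by rewrite big_ord0 subr0; exact: hs.
  by move=> c _; apply/rowP => -[].
pose U0 := U `&` in_span W s.
have sS := in_span_subspace s sW.
have sU0 : subspace_set U0.
  split; first by split; [exact: sub0|exact: sub0].
  by move=> a x y [Ux sx] [Uy sy]; split; [exact: subZD|exact: subZD].
have WU0 : W `<=` U0.
  move=> w Ww; split; first exact: WU.
  by apply: (@in_span_shift W W s w w) => //; rewrite subrr; exact: sub0 sS.
have [n [b' [Ub' hb']]] : exists n (b : 'I_n -> V), basis_mod U0 W b.
  by apply: IH => // v [].
have [UU0|/existsNP [u /not_implyP [Uu nU0u]]] := pselect (U `<=` U0).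
  exists n, b'; split=> [i|v /UU0 /hb' //]; by have [] := Ub' i.
have [c uc] := hs u Uu.
have c0 : c != 0.
  by apply: contra_notN nU0u => /eqP c0; move: uc; rewrite c0 scale0r subr0.
pose bb (i : 'I_n.+1) := oapp b' u (unlift ord0 i).
have sumE (d : 'rV[F]_n.+1) : \sum_(i < n.+1) d ord0 i *: bb i =
    d ord0 ord0 *: u + \sum_(i < n) (\row_i d ord0 (lift ord0 i)) ord0 i *: b' i.
  rewrite big_ord_recl /bb unlift_none /=; congr (_ + _).
  by apply: eq_bigr => i _; rewrite liftK mxE.
have subc v : U v -> exists t, U0 (v - t *: u).
  move=> Uv; have [d vd] := hs v Uv; exists (d / c); split.
    by apply: subB => //; apply: subZ.
  have /(_ sS) := subB _ vd (subZ sS (d / c) uc).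
  by rewrite scalerBr scalerA divfK // opprB addrA subrK; apply.
have uniqt v t t' : U0 (v - t *: u) -> U0 (v - t' *: u) -> t = t'.
  move=> h h'; have := subB sU0 h' h.
  rewrite opprB addrC addrA subrK -scalerBl => /(subZV sU0) h2.
  by apply/eqP; rewrite -subr_eq0; apply: contra_notT nU0u => /h2.
exists n.+1, bb; split.
  by move=> i; rewrite /bb; case: unliftP => [j _|_] //=; have [] := Ub' j.
move=> v Uv; have [t vt] := subc v Uv; have [d [vd du]] := hb' _ vt.
exists (\row_i oapp (fun j => d ord0 j) t (unlift ord0 i)); split.
  rewrite sumE !mxE unlift_none /= opprD addrA.
  rewrite (_ : \row_i _ = d) //; apply/rowP => i.
  by rewrite !mxE liftK /= (ord1 ord0).
move=> e; rewrite sumE opprD addrA => ve.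
have et : t = e ord0 ord0.
  apply: (uniqt v) => //.
  rewrite -(subrK (\sum_(i < n) (\row_i0 e ord0 (lift ord0 i0)) ord0 i *: b' i)
    (v - e ord0 ord0 *: u)).
  apply: (subD sU0); first exact: WU0.
  elim/big_ind : _ => [||i _]; [exact: sub0|exact: subD|exact: subZ].
rewrite -et in ve; have {}du := du _ ve.
apply/rowP => i; rewrite !mxE; case: unliftP => [j ->|->] /=.
  by rewrite du mxE.
by rewrite et.
Qed.

Lemma dim_mod_finP U W : subspace_set U -> subspace_set W -> W `<=` U ->
  (dim_mod U W < +oo)%E <-> fdim U W.
Proof.
move=> sU sW WU; rewrite /dim_mod; split.
  case: xgetP => [x _ [n [b [_ hb]] _] _|]; last by rewrite ltxx.
  exists [seq b i | i <- enum 'I_n] => v /hb [c [vc _]].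
  apply: (@in_span_sum _ _ _ b (fun i => c ord0 i)); by rewrite big_enum.
move=> /(fdim_basis sU sW WU) [n [b hb]].
case: xgetP => [x _ [m _ <-]|]; first exact: ltry.
by move=> /(_ n%:Z%:E) h; exfalso; apply: h; exists n => //; exists b.
Qed.

Lemma dim_mod_inf U W : subspace_set U -> subspace_set W -> W `<=` U ->
  ~ fdim U W -> dim_mod U W = +oo%E.
Proof.
move=> sU sW WU h; apply/eqP; rewrite -leye_eq leNgt; apply/negP.
by move=> /(dim_mod_finP sU sW WU).
Qed.
End InSpan.

Lemma subspace_setT (V : lmodType F) : subspace_set [set: V].
Proof. by []. Qed.

Lemma subspace_set0 (V : lmodType F) : subspace_set [set 0 : V].
Proof. by split => //= a x y -> ->; rewrite scaler0 addr0. Qed.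

Section Maps.
Variables (V V' : lmodType F) (f : {linear V -> V'}).

Lemma subspace_preimage W : subspace_set W -> subspace_set (f @^-1` W).
Proof.
by move=> [W0 WD]; split=> [|a x y] /=; rewrite ?linear0 ?linearP //; exact: WD.
Qed.

Lemma subspace_image W : subspace_set W -> subspace_set (f @` W).
Proof.
move=> [W0 WD]; split; first by exists 0; rewrite ?linear0.
move=> a _ _ [x Wx <-] [y Wy <-]; exists (a *: x + y); first exact: WD.
by rewrite linearP.
Qed.

Lemma fdim_image U W : fdim U W -> fdim (f @` U) (f @` W).
Proof.
move=> [s hs]; exists (map f s) => _ [u /hs us <-].
elim: s u us {hs} => [|b s IH] u /=; first by exists u.
by move=> [c /IH h]; exists c; rewrite -linearZ -linearB.
Qed.

(** A basis of [f U + W] modulo [W] may be lifted to [U] up to errors in [W];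
    the lifts generate [U] modulo the preimage of [W]. *)
Lemma fdim_preimage U W : subspace_set U -> subspace_set W ->
  fdim (f @` U) W -> fdim U (U `&` f @^-1` W).
Proof.
move=> sU sW [s hs]; have sI := subspace_image sU.
pose X := [set y | exists2 u, U u & W (y - f u)].
have sX : subspace_set X.
  split; first by exists 0; [exact: sub0 sU|rewrite linear0 subr0; exact: sub0 sW].
  move=> a x y [u Uu xu] [v Uv yv]; exists (a *: u + v); first exact: subZD.
  have := subZD sW a xu yv; congr (W _).
  by rewrite linearP scalerBr opprD addrACA.
have WX : W `<=` X.
  by move=> w Ww; exists 0; [exact: sub0 sU|rewrite linear0 subr0].
have [n [b [Xb hb]]] : exists n (b : 'I_n -> V'), basis_mod X W b.
  apply: fdim_basis => //; exists s => y [u Uu yu].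
  have sS := in_span_subspace s sW.
  rewrite -(subrKC (f u) y); apply: (subD sS); first by apply: hs; exists u.
  apply: (in_span_shift sW (@subset_refl _ W) yu); rewrite subrr; exact: sub0 sS.
have [u hu] := choice (fun i => let: ex_intro2 u Uu h := Xb i in
  ex_intro (fun u => U u /\ W (b i - f u)) u (conj Uu h)).
exists [seq u i | i <- enum 'I_n] => v Uv.
have /hb [c [vc _]] : X (f v).
  by exists v => //; rewrite subrr; exact: sub0 sW.
apply: (@in_span_sum _ _ _ _ u (fun i => c ord0 i)); rewrite big_enum /=; split.
  apply: subB => //; elim/big_ind : _ => [||i _]; [exact: sub0|exact: subD|].
  by apply: subZ => //; have [] := hu i.
rewrite /= linearB linear_sum /=.
have -> : f v - \sum_(i < n) f (c ord0 i *: u i) =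
    (f v - \sum_(i < n) c ord0 i *: b i) +
    \sum_(i < n) c ord0 i *: (b i - f (u i)).
  rewrite -addrA; congr (_ + _); rewrite addrC.
  rewrite -sumrB -sumrN; apply: eq_bigr => i _.
  by rewrite linearZ scalerBr addrC addKr.
apply: subD => //; elim/big_ind : _ => [||i _]; [exact: sub0|exact: subD|].
by apply: subZ => //; have [] := hu i.
Qed.
End Maps.
End FiniteDimension.

(** * Orthonormal families and Fourier multipliers *)

Section Topology.
Variable R : realType.

Lemma closed_preimage_lipschitz (H K : normedModType R[i]) (f : H -> K) M A :
  (forall x y, nm (f x - f y) <= M * nm (x - y)) -> closed A ->
  closed (f @^-1` A).
Proof.
move=> hf /closed_epsP cA; apply/closed_epsP => x hx.
have M0 : 0 < `|M| + 1 by rewrite ltr_wpDl.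
apply: cA => e e0; have [|y Ay xy] := hx (e / (`|M| + 1)); first by rewrite divr_gt0.
exists (f y) => //; apply: le_lt_trans (hf _ _) _.
rewrite ltr_pdivlMr // mulrC in xy; apply: le_lt_trans xy.
by apply: ler_wpM2r; [exact: nm_ge0|have := ler_norm M; lra].
Qed.

Lemma closed_preimage (H K : normedModType R[i]) (T : {linear H -> K}) A :
  bounded_op T -> closed A -> closed (T @^-1` A).
Proof.
move=> /bounded_opP [M _ hM]; apply: (@closed_preimage_lipschitz _ _ _ M) => x y.
by rewrite -linearB hM.
Qed.

Lemma closed_set0 (X : normedModType R[i]) : closed [set 0 : X].
Proof.
apply/closed_epsP => x hx /=.
by apply: nm_pos_eq0 => e e0; have [y /= ->] := hx e e0; rewrite subr0.
Qed.

Lemma closed_zeros (H : normedModType R[i]) (W : normedZmodType R[i]) (g : H -> W) M :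
  (forall x y, nm (g x - g y) <= M * nm (x - y)) -> closed [set x | g x = 0].
Proof.
move=> hg; apply/closed_epsP => x hx; apply: nm_pos_eq0 => e e0 /=.
have M0 : 0 < `|M| + 1 by rewrite ltr_wpDl.
have [|y /= gy xy] := hx (e / (`|M| + 1)); first by rewrite divr_gt0.
have := hg x y; rewrite gy subr0 => /le_lt_trans; apply.
rewrite ltr_pdivlMr // mulrC in xy; apply: le_lt_trans xy.
by apply: ler_wpM2r; [exact: nm_ge0|have := ler_norm M; lra].
Qed.

Lemma closed_seq_lim (H : normedModType R[i]) (A : set H) (u : nat -> H) l N :
  closed A -> seq_lim u l -> (forall n, (N <= n)%N -> A (u n)) -> A l.
Proof.
move=> /closed_epsP cA ul Au; apply: cA => e e0; have [M hM] := ul e e0.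
exists (u (maxn N M)); first by apply: Au; rewrite leq_maxl.
by apply: hM; rewrite leq_maxr.
Qed.

Lemma closed_le_nm (H : normedModType R[i]) (r : R) : closed [set x : H | nm x <= r].
Proof.
apply/closed_epsP => x hx /=; rewrite leNgt; apply/negP => rx.
have [|y /= yr xy] := hx (nm x - r); first by rewrite subr_gt0.
have := nmD (x - y) y; rewrite subrK; lra.
Qed.

(** The partial sums approach their supremum. *)
Lemma bounded_series_small (a : nat -> R) (b : R) :
  (forall i, 0 <= a i) -> (forall n, \sum_(0 <= i < n) a i <= b) ->
  forall e, 0 < e -> exists N, forall m n, (N <= m)%N -> (m <= n)%N ->
    \sum_(m <= i < n) a i < e.
Proof.
move=> a0 ab e e0; pose S := [set x | exists n, x = \sum_(0 <= i < n) a i].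
have hS : has_sup S.
  split; first by exists (\sum_(0 <= i < 0) a i), 0%N.
  by exists b => _ [n ->].
have [_ [N ->] hN] := sup_adherent e0 hS.
exists N => m n Nm mn.
have : \sum_(0 <= i < n) a i <= sup S by apply: sup_ubound; [case: hS|exists n].
rewrite (big_cat_nat (n := m)) //= (big_cat_nat (n := N) (p := m)) //=.
have : 0 <= \sum_(N <= i < m) a i by apply: sumr_ge0.
lra.
Qed.
End Topology.

Section InnerProduct.
Variables (R : realType) (H : hilbertType R).
Implicit Types x y z : H.

Lemma conj_realC (r : R) : Num.conj (r%:C : R[i]) = r%:C.
Proof. by apply: conj_Creal; apply/complex_realP; exists r. Qed.

Definition ip x y : R[i] := hdot x y.

Lemma ipDl x y z : ip (x + y) z = ip x z + ip y z.
Proof. exact: linearDl. Qed.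
Lemma ipZl a x z : ip (a *: x) z = a * ip x z.
Proof. exact: linearZl_LR. Qed.
Lemma ipNl x z : ip (- x) z = - ip x z.
Proof. by rewrite -scaleN1r ipZl mulN1r. Qed.
Lemma ipBl x y z : ip (x - y) z = ip x z - ip y z.
Proof. by rewrite ipDl ipNl. Qed.
Lemma ip0l z : ip 0 z = 0.
Proof. by rewrite -(scale0r 0) ipZl mul0r. Qed.
Lemma ipC x y : ip x y = Num.conj (ip y x).
Proof. by rewrite /ip hermC expr0 mul1r. Qed.
Lemma ipDr x y z : ip z (x + y) = ip z x + ip z y.
Proof. by rewrite ipC ipDl rmorphD /= -!ipC. Qed.
Lemma ipZr a x z : ip z (a *: x) = Num.conj a * ip z x.
Proof. by rewrite ipC ipZl rmorphM /= -ipC. Qed.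
Lemma ip0r z : ip z 0 = 0.
Proof. by rewrite ipC ip0l rmorph0. Qed.
Lemma ipNr x z : ip z (- x) = - ip z x.
Proof. by rewrite ipC ipNl rmorphN /= -ipC. Qed.
Lemma ipBr x y z : ip z (x - y) = ip z x - ip z y.
Proof. by rewrite ipDr ipNr. Qed.
Lemma ip_sym0 x y : ip x y = 0 -> ip y x = 0.
Proof. by move=> h; rewrite ipC h rmorph0. Qed.
Lemma ip_suml I r (P : pred I) (F : I -> H) z :
  ip (\sum_(i <- r | P i) F i) z = \sum_(i <- r | P i) ip (F i) z.
Proof. by apply: (big_morph (ip^~ z)) => [x y|]; rewrite ?ipDl ?ip0l. Qed.

Lemma ip_nm x : ip x x = (nm x ^+ 2)%:C.
Proof. by rewrite /ip hdotE nmE rmorphXn. Qed.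
Lemma ip_eq0 x : ip x x = 0 -> x = 0.
Proof.
rewrite ip_nm => /complexI/eqP; rewrite sqrf_eq0 => /eqP; exact: nm_eq0.
Qed.

Lemma pythagoras x y : ip x y = 0 -> nm (x + y) ^+ 2 = nm x ^+ 2 + nm y ^+ 2.
Proof.
move=> h; apply: complexI; rewrite rmorphD /= -!ip_nm ipDl !ipDr h.
by rewrite (ip_sym0 h) addr0 add0r.
Qed.

Lemma cauchy_schwarz x y : nm (ip x y) <= nm x * nm y.
Proof.
have [->|y0] := eqVneq y 0; first by rewrite ip0r !nm0 mulr0.
have yy0 : ip y y != 0 by apply: contra y0 => /eqP/ip_eq0->.
have ny := nm_gt0 y0.
pose a := ip x y / ip y y; pose z := x - a *: y.
have zy : ip (a *: y) z = 0.
  by rewrite ipZl ip_sym0 ?mulr0 // /z ipBl ipZl divfK // subrr.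
have := pythagoras zy; rewrite /z subrKC nmZ exprMn => xE.
have na : nm a * nm y ^+ 2 = nm (ip x y).
  have -> : nm y ^+ 2 = nm (ip y y) by rewrite ip_nm nm_real ger0_norm // sqr_ge0.
  by rewrite -nmM divfK.
rewrite -na expr2 mulrA ler_pM2r //.
rewrite -(@ler_pXn2r _ 2) ?nnegrE ?mulr_ge0 ?nm_ge0 //.
by rewrite xE exprMn lerDl sqr_ge0.
Qed.

Lemma closed_ip (v : H) c : closed [set y | ip y v = c].
Proof.
have -> : [set y | ip y v = c] = [set y | ip y v - c = 0].
  apply/seteqP; split => y /=; first by move=> ->; rewrite subrr.
  by move/eqP; rewrite subr_eq0 => /eqP.
apply: (@closed_zeros _ _ _ _ (nm v)) => x y.
by rewrite opprB addrA subrK -ipBl mulrC cauchy_schwarz.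
Qed.

Definition perp (W : set H) : set H := [set y | forall w, W w -> ip y w = 0].

Lemma perp_subspace W : subspace_set (perp W).
Proof.
split=> [w _|a x y hx hy w Ww]; first by rewrite ip0l.
by rewrite ipDl ipZl hx // hy // mulr0 addr0.
Qed.

Lemma perp_closed W : closed (perp W).
Proof.
apply/closed_epsP => x hx w Ww; apply: ((closed_epsP [set y | ip y w = 0]).1 (@closed_ip w 0)) => e e0.
by have [y hy xy] := hx e e0; exists y => //=; exact: hy.
Qed.

(** Zero vectors are allowed so that the Gram-Schmidt process may keep the
    numbering of its input. *)
Definition suborthonormal (e : nat -> H) :=
  forall i j, ip (e i) (e j) = ((i == j) && (e i != 0))%:R.

Definition orthonormal_seq (e : nat -> H) :=
  forall i j, ip (e i) (e j) = (i == j)%:R.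

Lemma orthonormal_neq0 e i : orthonormal_seq e -> e i != 0.
Proof.
move=> oe; apply/eqP => ei; have /eqP := oe i i.
by rewrite ei ip0l eqxx eq_sym oner_eq0.
Qed.

Lemma orthonormal_sub e : orthonormal_seq e -> suborthonormal e.
Proof. by move=> oe i j; rewrite oe orthonormal_neq0 // andbT. Qed.

Section Bessel.
Variables (e : nat -> H) (oe : suborthonormal e).

Lemma suborthonormal_nm i : nm (e i) = (e i != 0)%:R.
Proof.
apply/eqP; rewrite -(@eqrXn2 _ 2) ?nm_ge0 ?ler0n //; apply/eqP/complexI.
rewrite -ip_nm oe eqxx /=; by case: (e i != 0); rewrite ?expr1n // expr0n.
Qed.

Lemma suborthonormal_ipK x i : ip x (e i) * ip (e i) (e i) = ip x (e i).
Proof.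
rewrite oe eqxx /=; have [->|] := eqVneq (e i) 0; first by rewrite ip0r mul0r.
by rewrite mulr1.
Qed.

Lemma nm_sum_suborthonormal (c : nat -> R[i]) m n :
  nm (\sum_(m <= i < n) c i *: e i) ^+ 2 <= \sum_(m <= i < n) nm (c i) ^+ 2.
Proof.
elim: n => [|n IH]; first by rewrite !big_geq // nm0 expr0n.
have [mn|nm] := leqP m n; last by rewrite !big_geq // nm0 expr0n.
rewrite !big_nat_recr //= pythagoras.
  rewrite lerD // nmZ exprMn ler_piMr ?sqr_ge0 //.
  by rewrite suborthonormal_nm; case: (_ != _); rewrite ?expr1n // expr0n ler01.
rewrite ip_suml big_nat big1 // => i /andP[_ ltin].
by rewrite ipZl ipZr oe (ltn_eqF ltin) !mulr0.
Qed.

Lemma ip_partial_sum (c : nat -> R[i]) n j : (j < n)%N ->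
  ip (\sum_(0 <= i < n) c i *: e i) (e j) = c j * ip (e j) (e j).
Proof.
move=> jn; rewrite ip_suml (bigD1_seq j) ?mem_index_iota ?iota_uniq //=.
rewrite ipZl big1 ?addr0 // => i ij.
by rewrite ipZl oe (negPf ij) mulr0.
Qed.

(** The partial Fourier sum is orthogonal to the remainder. *)
Lemma bessel x n : \sum_(0 <= i < n) nm (ip x (e i)) ^+ 2 <= nm x ^+ 2.
Proof.
pose p := \sum_(0 <= i < n) ip x (e i) *: e i.
have pz j : (j < n)%N -> ip (x - p) (e j) = 0.
  by move=> jn; rewrite ipBl /p ip_partial_sum // suborthonormal_ipK subrr.
have h : ip p (x - p) = 0.
  rewrite ip_suml big_nat big1 // => i /andP[_ ltin].
  by rewrite ipZl (ip_sym0 (pz i ltin)) mulr0.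
have := pythagoras h; rewrite subrKC => ->; apply: ler_wpDr; first exact: sqr_ge0.
rewrite -lecR -ip_nm {2}/p.
have -> : ip p (\sum_(0 <= i < n) ip x (e i) *: e i) =
   \sum_(0 <= i < n) (nm (ip x (e i)) ^+ 2)%:C.
  rewrite ipC ip_suml rmorph_sum /= !big_nat; apply: eq_bigr => i /andP[_ lin].
  rewrite ipZl rmorphM /= -[X in _ * X]ipC /p ip_partial_sum // suborthonormal_ipK.
  by rewrite mulrC -normCK nmE rmorphXn.
by rewrite rmorph_sum.
Qed.
End Bessel.
End InnerProduct.

Section FourierMultiplier.
Variables (R : realType) (H K : hilbertType R).
Variables (e : nat -> K) (f : nat -> H) (b : nat -> R[i]) (M : R).
Hypotheses (oe : suborthonormal e) (of_ : suborthonormal f).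
Hypothesis bM : forall n, nm (b n) <= M.

Let S x n := \sum_(0 <= i < n) (b i * ip x (e i)) *: f i.

Let M0 : 0 <= M.
Proof. exact: le_trans (nm_ge0 _) (bM 0). Qed.

Let S_tail x m n :
  nm (\sum_(m <= i < n) (b i * ip x (e i)) *: f i) ^+ 2 <=
  M ^+ 2 * \sum_(m <= i < n) nm (ip x (e i)) ^+ 2.
Proof.
apply: le_trans (nm_sum_suborthonormal of_ _ _ _) _.
rewrite mulr_sumr; apply: ler_sum => i _; rewrite nmM exprMn.
by apply: ler_wpM2r; rewrite ?sqr_ge0 // lerXn2r ?nnegrE ?nm_ge0.
Qed.

Let S_cauchy x : seq_cauchy (S x).
Proof.
move=> d d0; pose M1 := M + 1; have M10 : 0 < M1 by rewrite ltr_wpDl.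
have [N hN] : exists N, forall m n, (N <= m)%N -> (m <= n)%N ->
    \sum_(m <= i < n) nm (ip x (e i)) ^+ 2 < (d / M1) ^+ 2.
  apply: (@bounded_series_small _ _ (nm x ^+ 2)) => [i|n|].
  - exact: sqr_ge0.
  - exact: bessel.
  - by rewrite exprn_gt0 ?divr_gt0.
have main m n : (N <= m)%N -> (m <= n)%N -> nm (S x m - S x n) < d.
  move=> Nm mn; rewrite /S (big_cat_nat (n := m) (p := n)) //= opprD addNKr nmN.
  have h := hN m n Nm mn; have h' := S_tail x m n.
  rewrite -(@ltr_pXn2r _ 2) ?nnegrE ?nm_ge0 ?(ltW d0) //.
  apply: le_lt_trans h' _.
  rewrite expr_div_n ltr_pdivlMr ?exprn_gt0 // mulrC in h.
  apply: le_lt_trans h; apply: ler_wpM2r; first by apply: sumr_ge0 => i _; exact: sqr_ge0.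
  by rewrite lerXn2r ?nnegrE ?(ltW M10) // lerDl.
exists N => m n Nm Nn; have [mn|/ltnW lenm] := leqP m n; first exact: main.
by rewrite nmC; exact: main.
Qed.

(** The operator x |-> sum_n b_n <x, e_n> f_n. The series converges since its
    tails are controlled by the tails in Bessel's inequality. Taking [e = f]
    and [b = 1] gives orthogonal projections, [b = 1] gives partial isometries,
    and general [b] inverts an operator with orthogonal images. *)
Lemma fourier_multiplier : exists D : {linear K -> H},
  [/\ bounded_op D,
      forall x n, ip (D x) (f n) = b n * ip x (e n) * ip (f n) (f n) &
      forall N : set H, subspace_set N -> closed N -> (forall n, N (f n)) ->
        forall x, N (D x)].
Proof.
have [D hD] := choice (fun x => complete_seq (@S_cauchy x)).
have linD : linear D.
  move=> a x y; apply: (@seq_lim_uniq _ _ (S (a *: x + y)) _ _ (hD _)) => d d0.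
  pose c := nm a + 1; have c0 : 0 < c by rewrite ltr_wpDl ?nm_ge0.
  have [|N1 h1] := hD x (d / 2 / c); first by rewrite !divr_gt0.
  have [|N2 h2] := hD y (d / 2); first by rewrite divr_gt0.
  exists (maxn N1 N2) => n; rewrite geq_max => /andP[n1 n2].
  have -> : S (a *: x + y) n = a *: S x n + S y n.
    rewrite /S scaler_sumr -big_split /=; apply: eq_bigr => i _.
    by rewrite ipDl ipZl scalerA -scalerDl mulrDr mulrCA.
  rewrite opprD addrACA -scalerBr; apply: le_lt_trans (nmD _ _) _.
  have k2 := h2 n n2; have := h1 n n1; rewrite ltr_pdivlMr // nmZ => k1.
  have : nm a * nm (D x - S x n) <= nm (D x - S x n) * c.
    by rewrite mulrC ler_wpM2l ?nm_ge0 // lerDl.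
  lra.
exists (HB.pack D (GRing.isLinear.Build _ _ _ _ _ linD) : {linear K -> H}).
split=> [|x n|N sN cN Nf x] /=.
- apply/bounded_opP; exists (M + 1) => [|x /=]; first by rewrite ltr_wpDl.
  apply: (@closed_seq_lim _ _ [set y | nm y <= (M + 1) * nm x] (S x) _ 0 _ (hD x)) => //.
    exact: closed_le_nm.
  move=> n _ /=; rewrite -(@ler_pXn2r _ 2) ?nnegrE ?mulr_ge0 ?nm_ge0 ?addr_ge0 //.
  apply: le_trans (S_tail _ _ _) _; rewrite exprMn; apply: ler_pM.
  + exact: sqr_ge0.
  + by apply: sumr_ge0 => i _; exact: sqr_ge0.
  + by rewrite lerXn2r ?nnegrE ?addr_ge0 // lerDl.
  + exact: bessel.
- apply: (@closed_seq_lim _ _ [set y | ip y (f n) = b n * ip x (e n) * ip (f n) (f n)] (S x) _ n.+1 _ (hD x)) => //.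
    exact: closed_ip.
  by move=> m nm /=; rewrite /S ip_partial_sum.
- apply: (@closed_seq_lim _ _ N (S x) _ 0 _ (hD x)) => // n _; rewrite /S.
  by elim/big_ind : _ => [||i _]; [exact: sub0|exact: subD|exact: subZ].
Qed.
End FourierMultiplier.

(** * Orthonormal bases and orthogonal projections *)

(** Dependent choice in which each term may depend on all earlier ones. *)
Lemma history_choice (T : Type) (P : seq T -> T -> Prop) :
  (forall s, exists x, P s x) ->
  exists f : nat -> T, forall n, P (mkseq f n) (f n).
Proof.
move=> /choice [g hg].
pose h := fix h n := if n is m.+1 then rcons (h m) (g (h m)) else [::].
exists (g \o h) => n; suff -> : mkseq (g \o h) n = h n by exact: hg.
by elim: n => [//|n IH]; rewrite mkseqS IH.
Qed.

Section OrthonormalBases.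
Variable R : realType.

Section OneSpace.
Variable H : hilbertType R.
Implicit Types (M W : set H) (e : nat -> H) (x y : H).

Lemma perp_id W x : W x -> perp W x -> x = 0.
Proof. by move=> Wx /(_ _ Wx) /ip_eq0. Qed.

Lemma normalize x : x != 0 -> exists2 c : R[i], c != 0 & nm (c *: x) = 1.
Proof.
move=> x0; have n0 := nm_gt0 x0; exists ((nm x)^-1)%:C.
  by rewrite eq_complex /= eqxx andbT invr_eq0 gt_eqF.
by rewrite nmZ nm_real ger0_norm ?invr_ge0 ?(ltW n0) // mulVf // gt_eqF.
Qed.

(** Each hyperplane either contains [W] or is complemented in [W] by a single
    vector, so it lowers the dimension by at most one. *)
Lemma fdim_hyperplanes W (s : seq H) : subspace_set W ->
  fdim (W `&` [set x | forall v, v \in s -> ip x v = 0]) [set 0] ->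
  fdim W [set 0].
Proof.
elim: s W => [|g s IH] W sW.
  by apply: fdimS => // x Wx; split=> // v; rewrite in_nil.
move=> h; pose W' := W `&` [set x | ip x g = 0].
have sW' : subspace_set W'.
  split; first by split; [exact: sub0|rewrite /= ip0l].
  move=> a x y [Wx /= gx] [Wy /= gy]; split; first exact: subZD.
  by rewrite /= ipDl ipZl gx gy mulr0 addr0.
have fW' : fdim W' [set 0].
  apply: IH => //; apply: fdimS h => // x [[Wx /= gx] sx]; split=> // v.
  by rewrite inE => /predU1P[->//|/sx].
apply: fdim_trans fW'.
have [W0|/existsNP [w /not_implyP [Ww gw]]] := pselect (forall w, W w -> ip w g = 0).
  by exists [::] => w Ww; split=> //; exact: W0.
exists [:: w] => v Wv; exists (ip v g / ip w g); split.
  by apply: subB => //; exact: subZ.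
by rewrite /= ipBl ipZl divfK ?subrr //; apply/eqP.
Qed.

Lemma inf_unit_ortho W (s : seq H) : subspace_set W -> ~ fdim W [set 0] ->
  exists x, [/\ W x, nm x = 1 & forall v, v \in s -> ip x v = 0].
Proof.
move=> sW nW; apply: contrapT => h; apply: nW.
apply: (@fdim_hyperplanes _ s) => //; exists [::] => x [Wx hx] /=.
apply/eqP/negPn/negP => x0; apply: h; have [c c0 cx] := normalize x0.
exists (c *: x); split=> //; first exact: subZ.
by move=> v vs; rewrite ipZl hx // mulr0.
Qed.

Lemma ip_unit x : nm x = 1 -> ip x x = 1.
Proof. by move=> h; rewrite ip_nm h expr1n. Qed.

Lemma orthonormal_of_prev e :
  (forall n, nm (e n) = 1) -> (forall n m, (m < n)%N -> ip (e n) (e m) = 0) ->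
  orthonormal_seq e.
Proof.
move=> e1 eo i j; have [ij|ji|->] := ltngtP i j.
- by apply: ip_sym0; exact: eo.
- exact: eo.
- exact: ip_unit.
Qed.

Lemma inf_orthonormal W : subspace_set W -> ~ fdim W [set 0] ->
  exists e, orthonormal_seq e /\ forall n, W (e n).
Proof.
move=> sW nW.
have [e he] := history_choice (fun s => inf_unit_ortho s sW nW).
exists e; split=> [|n]; last by have [] := he n.
apply: orthonormal_of_prev => [n|n m mn]; first by have [] := he n.
have [_ _] := he n; apply; apply/mapP; exists m => //.
by rewrite mem_iota.
Qed.

(** Dependent input vectors yield the zero vector, thanks to [0^-1 = 0]. *)
Lemma gram_schmidt (s : nat -> H) : exists e, [/\ suborthonormal e,
  forall M, subspace_set M -> (forall n, M (s n)) -> forall n, M (e n) &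
  forall y, (forall n, ip y (e n) = 0) -> forall n, ip y (s n) = 0].
Proof.
pose z p := s (size p) - \sum_(x <- p) ip (s (size p)) x *: x.
have [e he] : exists e, forall n, e n =
    ((nm (z (mkseq e n)))^-1)%:C *: z (mkseq e n).
  apply: (@history_choice _ (fun p x => x = ((nm (z p))^-1)%:C *: z p)).
  by move=> p; exists (((nm (z p))^-1)%:C *: z p).
pose r n := z (mkseq e n).
have rE n : r n = s n - \sum_(0 <= i < n) ip (s n) (e i) *: e i.
  by rewrite /r /z size_mkseq /mkseq big_map /index_iota subn0.
have {}he n : e n = ((nm (r n))^-1)%:C *: r n by exact: he.
have re n : r n = (nm (r n))%:C *: e n.
  have [r0|/nm_gt0 r0] := eqVneq (r n) 0; first by rewrite r0 nm0 scale0r.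
  by rewrite he scalerA -rmorphM divff ?gt_eqF // scale1r.
have oe : suborthonormal e.
  suff h n i j : (i < n)%N -> (j < n)%N ->
      ip (e i) (e j) = ((i == j) && (e i != 0))%:R.
    by move=> i j; apply: (h (maxn i j).+1); rewrite ltnS ?leq_maxl ?leq_maxr.
  elim: n i j => [//|n IH] i j.
  (* truncating e after n terms turns the induction hypothesis into the full
     orthogonality needed by the lemmas on suborthonormal families *)
  have oe' : suborthonormal (fun i => if (i < n)%N then e i else 0).
    move=> k l /=; case: ifP => kn; last by rewrite ip0l eqxx andbF.
    case: ifP => ln; first exact: IH.
    rewrite ip0r; suff -> : (k == l) = false by [].
    by apply/eqP => kl; rewrite -kl kn in ln.
  have rj k : (k < n)%N -> ip (r n) (e k) = 0.
    move=> kn; rewrite rE ipBl big_nat.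
    have -> : \sum_(0 <= i < n | (0 <= i < n)%N) ip (s n) (e i) *: e i =
        \sum_(0 <= i < n) ip (s n) (e i) *: (if (i < n)%N then e i else 0).
      by rewrite [RHS]big_nat; apply: eq_bigr => l /andP[_ ->].
    have := ip_partial_sum oe' (fun i => ip (s n) (e i)) kn; rewrite kn => ->.
    have := suborthonormal_ipK oe' (s n) k; rewrite kn => ->; exact: subrr.
  have ek k : (k < n)%N -> ip (e n) (e k) = 0.
    by move=> kn; rewrite he ipZl rj // mulr0.
  rewrite !ltnS (leq_eqVlt i) (leq_eqVlt j) => /predU1P[->|li] /predU1P[->|lj].
  - rewrite eqxx /=; have [->|e0] := eqVneq (e n) 0; first by rewrite ip0l.
    rewrite ip_unit // he nmZ nm_real ger0_norm ?invr_ge0 ?nm_ge0 // mulVf //.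
    apply: contra e0 => /eqP/nm_eq0 r0; by rewrite he r0 scaler0.
  - by rewrite ek // (gtn_eqF lj).
  - by rewrite ip_sym0 ?ek // (ltn_eqF li).
  - exact: IH.
exists e; split=> // [M sM Ms|y hy n].
- move=> n; have [m] := ubnP n; elim: m n => // m IH n nm.
  rewrite he; apply: subZ => //; rewrite rE; apply: subB => //.
  rewrite big_nat; elim/big_ind : _ => [||i /andP[_ lin]].
  + exact: sub0.
  + exact: subD.
  + by apply: subZ => //; apply: IH; rewrite (leq_trans lin) // -ltnS.
- have -> : s n = r n + \sum_(0 <= i < n) ip (s n) (e i) *: e i.
    by rewrite rE subrK.
  apply: ip_sym0; rewrite ipDl re ipZl (ip_sym0 (hy n)) mulr0 add0r ip_suml.
  by rewrite big1 // => i _; rewrite ipZl (ip_sym0 (hy i)) mulr0.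
Qed.

Hypothesis sepH : separable_space H.

(** For each point [d n] of a dense sequence of the space and each radius
    [1 / k.+1], pick a point of [M] in that ball if there is one. *)
Lemma dense_sequence M : M 0 -> exists s : nat -> H,
  (forall n, M (s n)) /\
  forall x, M x -> forall d : R, 0 < d -> exists n, nm (x - s n) < d.
Proof.
move=> M0; have [D [cD dD]] := sepH.
have [d hd] : exists d : nat -> H, forall x (r : R), 0 < r -> exists n, nm (d n - x) < r.
  have near_D x r : 0 < r -> exists2 y, D y & nm (y - x) < r.
    move=> r0; have [||y [xy Dy]] := dD (ball x r%:C).
    - by exists x; apply: ballxx; rewrite ltcR.
    - by apply: ball_open; rewrite ltcR.
    - by exists y => //; rewrite nmC; move/ball_nmP: xy.
  case/pfcard_geP: cD => [D0|[f]].
    by have [y] := near_D 0 1 ltr01; rewrite D0.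
  exists f => x r /(near_D x) [y Dy yx].
  by have [n _ fn] := 'surj_f Dy; exists n; rewrite fn.
pose s m := if unpickle m is Some (n, k) then
    xget 0 [set y | M y /\ nm (d n - y) < k.+1%:R^-1] else 0.
exists s; split=> [m|x Mx e e0].
  by rewrite /s; case: unpickle => [[n k]|//]; case: xgetP => // y _ [].
pose k := Num.truncn (2 / e).
have k1 : k.+1%:R^-1 < e / 2.
  by rewrite -[e / 2]invf_div ltf_pV2 ?posrE ?divr_gt0 // truncnS_gt.
have [n nx] : exists n, nm (d n - x) < k.+1%:R^-1 by apply: hd; rewrite invr_gt0.
exists (pickle (n, k)); rewrite /s pickleK /=.
set A := [set y | _]; have [My yn] : A (xget 0 A) by apply: (@xgetI _ _ _ x).
move: yn; set y := xget 0 A => yn; have := nm_tri (d n) x y.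
rewrite (nmC x (d n)); move: k1 nx yn; move: (k.+1%:R^-1) => q; lra.
Qed.

Lemma suborthonormal_basis M : subspace_set M -> closed M ->
  exists e, [/\ suborthonormal e, forall n, M (e n) &
    forall y, (forall n, ip y (e n) = 0) -> perp M y].
Proof.
move=> sM cM; have [s [Ms sd]] := dense_sequence (sub0 sM).
have [e [oe Me es]] := gram_schmidt s.
exists e; split=> // [|y hy x Mx]; first exact: Me.
apply: ip_sym0; apply: ((closed_epsP [set x | ip x y = 0]).1 (@closed_ip _ _ y 0)).
move=> d /(sd _ Mx) [n xn]; exists (s n) => //=.
by apply: ip_sym0; exact: es.
Qed.

Lemma projection M : subspace_set M -> closed M ->
  exists P : {linear H -> H},
    [/\ bounded_op P, forall x, M (P x) & forall x, perp M (x - P x)].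
Proof.
move=> sM cM; have [e [oe Me eM]] := suborthonormal_basis sM cM.
have [|P [bP Pe PM]] := @fourier_multiplier _ _ _ e e (fun=> 1) 1 oe oe.
  by move=> n; rewrite -[1]/(1%:C) nm_real normr1.
exists P; split=> // [x|x]; first exact: PM.
apply: eM => n; rewrite ipBl Pe mul1r suborthonormal_ipK //; exact: subrr.
Qed.

Definition orthonormal_basis M e := [/\ orthonormal_seq e, forall n, M (e n) &
    forall y, (forall n, ip y (e n) = 0) -> perp M y].

(** Only finitely many nonzero vectors would make the finite Fourier sums
    reproduce every vector of [M]; so the nonzero vectors of a suborthonormal
    basis can be renumbered by all natural numbers. *)
Lemma infinite_basis M : subspace_set M -> closed M -> ~ fdim M [set 0] ->
  exists e, orthonormal_basis M e.
Proof.
move=> sM cM nM; have [e [oe Me eM]] := suborthonormal_basis sM cM.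
pose A := [set n | e n != 0].
have infA : infinite_set A.
  move=> /finite_seqP [s sA]; apply: nM.
  pose N := (\max_(i <- s) i).+1.
  have eN n : (N <= n)%N -> e n = 0.
    move=> Nn; apply/eqP/negPn/negP => en.
    have ns : n \in s by have : A n by []; rewrite sA.
    have := @leq_bigmax_seq _ s xpredT id n ns isT.
    by rewrite leqNgt; apply/negP; rewrite negbK.
  exists [seq e i | i <- index_iota 0 N] => x Mx.
  pose p := \sum_(0 <= i < N) ip x (e i) *: e i.
  have Mp : M p by rewrite /p; elim/big_ind : _ => [||i _]; [exact: sub0|exact: subD|exact: subZ].
  have /(perp_id (subB sM Mx Mp)) : perp M (x - p).
    apply: eM => n; rewrite ipBl; have [nN|/eN->] := ltnP n N; last by rewrite !ip0r subr0.
    by rewrite /p ip_partial_sum // suborthonormal_ipK // subrr.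
  by move=> xp; exact: (@in_span_sum _ _ _ _ _ e (fun i => ip x (e i))).
have /card_eqPle/card_set_bijP [f [fA finj fsurj]] :
    ([set: nat] #<= A)%card /\ (A #<= [set: nat])%card.
  by split; [exact/infiniteP|exact: card_leT].
exists (e \o f); split=> [i j|n|y hy] /=.
- rewrite oe; have /= -> := fA i Logic.I; rewrite andbT.
  by congr (nat_of_bool _)%:R; apply/eqP/eqP => [|->//]; apply: finj; rewrite inE.
- exact: Me.
- apply: eM => n; have [->|en] := eqVneq (e n) 0; first by rewrite ip0r.
  by have [m _ <-] := fsurj n en; exact: hy.
Qed.
End OneSpace.

Section TwoSpaces.
Variables H K : hilbertType R.

Lemma basis_transfer (M : set K) (N : set H) (e : nat -> K) (f : nat -> H) :
  subspace_set M -> closed M -> subspace_set N -> closed N ->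
  orthonormal_basis M e -> orthonormal_basis N f ->
  exists U : {linear K -> H}, [/\ bounded_op U, forall x, N (U x),
    forall x n, ip (U x) (f n) = ip x (e n) & forall x, perp M x -> U x = 0].
Proof.
move=> sM cM sN cN [oe Me eM] [of_ Nf fN].
have [|U [bU Uf UN]] := @fourier_multiplier _ _ _ e f (fun=> 1) 1
    (orthonormal_sub oe) (orthonormal_sub of_).
  by move=> n; rewrite -[1]/(1%:C) nm_real normr1.
have UfE x n : ip (U x) (f n) = ip x (e n).
  by rewrite Uf of_ eqxx mul1r mulr1.
exists U; split=> // [x|x ox]; first exact: UN.
apply: (@perp_id _ N); first exact: UN.
by apply: fN => n; rewrite UfE; exact: ox.
Qed.
End TwoSpaces.
End OrthonormalBases.

(** * The open mapping theorem *)

Section OpenMapping.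
Variable R : realType.

Lemma seq_lim_nm_le (V : normedModType R[i]) (u : nat -> V) l a (r : R) N :
  seq_lim u l -> (forall n, (N <= n)%N -> nm (u n - a) <= r) -> nm (l - a) <= r.
Proof.
move=> ul ur; rewrite leNgt; apply/negP => rl.
have [|M hM] := ul (nm (l - a) - r); first by rewrite subr_gt0.
have := hM (maxn N M) (leq_maxr _ _); have := ur (maxn N M) (leq_maxl _ _).
have := nm_tri (u (maxn N M)) l a; lra.
Qed.

Lemma half_pow_small (e : R) : 0 < e ->
  exists N, forall n, (N <= n)%N -> 2^-1 ^+ n < e.
Proof.
move=> e0; exists (Num.truncn e^-1).+1 => n Nn.
rewrite exprVn -(invrK e) ltf_pV2 ?posrE ?exprn_gt0 ?invr_gt0 //.
apply: lt_le_trans (truncnS_gt _) _; rewrite -natrX ler_nat.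
by apply: leq_trans Nn _; apply: ltnW; exact: ltn_expl.
Qed.

Lemma half_pow_gt0 n : 0 < 2^-1 ^+ n :> R.
Proof. by rewrite exprn_gt0 // invr_gt0. Qed.

(** The constant 2 is the sum of the geometric series of ratio 1/2. *)
Lemma geometric_limit (V : normedModType R[i]) (u : nat -> V) (C : R) :
  seq_complete V -> 0 < C -> (forall n, nm (u n.+1 - u n) <= C * 2^-1 ^+ n) ->
  exists l, seq_lim u l /\ forall n, nm (l - u n) <= 2 * C * 2^-1 ^+ n.
Proof.
move=> cV C0 hu.
have hk n k : nm (u (n + k)%N - u n) <= 2 * C * (2^-1 ^+ n - 2^-1 ^+ (n + k)).
  elim: k => [|k IH]; first by rewrite addn0 !subrr nm0 mulr0.
  have := nm_tri (u (n + k)%N) (u (n + k.+1)%N) (u n); rewrite addnS.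
  have := hu (n + k)%N; rewrite exprSr; nra.
have hm n m : (n <= m)%N -> nm (u m - u n) <= 2 * C * 2^-1 ^+ n.
  move=> nm; rewrite -(subnKC nm); apply: le_trans (hk _ _) _.
  by rewrite ler_wpM2l ?mulr_ge0 // ?(ltW C0) // gerBl ltW // half_pow_gt0.
have [|l ul] := cV u.
  move=> e e0; have [|N hN] := half_pow_small (e := e / (4 * C)).
    by rewrite divr_gt0 // mulr_gt0.
  exists N => m n Nm Nn; have := nm_tri (u N) (u m) (u n).
  have := hm N m Nm; have := hm N n Nn; rewrite (nmC (u N)).
  have := hN N (leqnn N); rewrite ltr_pdivlMr ?mulr_gt0 //; lra.
exists l; split=> // n; apply: (seq_lim_nm_le ul) => m; exact: hm.
Qed.

Variables (X Y : normedModType R[i]) (T : {linear X -> Y}).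
Hypotheses (cX : seq_complete X) (cY : seq_complete Y).
Hypotheses (bT : bounded_op T) (cT : closed (range T)).

(** Baire category argument inside the closed range: otherwise nested balls
    with centres in the range could avoid the image of each ball of integer
    radius in turn, and their common point, which lies in the closed range,
    would have no preimage. *)
Lemma range_dense_ball : exists (n : nat) (y0 : Y) (r : R), [/\ range T y0, 0 < r &
  forall y, range T y -> nm (y - y0) < r -> forall e : R, 0 < e ->
    exists x, nm x <= n%:R /\ nm (y - T x) < e].
Proof.
apply: contrapT => no.
have step (q : nat * (Y * R)) : exists p : Y * R, range T q.2.1 -> 0 < q.2.2 ->
  [/\ range T p.1, 0 < p.2, p.2 <= q.2.2 / 2, nm (p.1 - q.2.1) + p.2 <= q.2.2 &
   forall x, nm x <= q.1%:R -> p.2 < nm (p.1 - T x)].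
  case: q => n [y0 r] /=.
  have [Ry0|nRy0] := pselect (range T y0); last by exists (0, 0) => /nRy0.
  have [r0|nr0] := pselect (0 < r); last by exists (0, 0) => _ /nr0.
  apply: contrapT => hp; apply: no; exists n, y0, r; split=> // y Ry yr e e0.
  apply: contrapT => hx; apply: hp.
  pose r' := Num.min (e / 2) (Num.min (r / 2) (r - nm (y - y0))).
  have r'0 : 0 < r' by rewrite /r' !lt_min; apply/and3P; split; lra.
  have : r' <= r' by []; rewrite {2}/r' !le_min => /and3P[re rr ry].
  exists (y, r') => _ _; split=> //=; first by lra.
  move=> x xn; rewrite ltNge; apply/negP => h; apply: hx; exists x; split=> //.
  by apply: le_lt_trans h _; lra.
have [g hg] := choice step.
pose p := fix p n := if n is m.+1 then g (m, p m) else (0 : Y, 1 : R).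
have pR n : range T (p n).1 /\ 0 < (p n).2.
  elim: n => [|n [IH1 IH2]] /=; first by split=> //; exists 0; rewrite ?linear0.
  by have [] := hg (n, p n) IH1 IH2.
have pS n := hg (n, p n) (pR n).1 (pR n).2.
have p2 n : (p n).2 <= 2^-1 ^+ n.
  elim: n => [//|n IH]; have [_ _ h _ _] := pS n; rewrite exprSr /=.
  apply: le_trans h _ => /=; lra.
have pnest n m : (n <= m)%N -> nm ((p m).1 - (p n).1) + (p m).2 <= (p n).2.
  move=> /subnKC <-; elim: (m - n)%N => [|k IH].
    by rewrite addn0 subrr nm0 add0r.
  have [_ _ _ h _] := pS (n + k)%N; rewrite addnS.
  have := nm_tri (p (n + k)%N).1 (p (n + k).+1).1 (p n).1.
  move: h IH => /=; lra.
have [|n|l [ul _]] := @geometric_limit _ (fun n => (p n).1) 1 cY; first by [].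
  have := pnest n n.+1 (leqnSn n); have [_ h] := pR n.+1; have := p2 n; lra.
have ln n : nm (l - (p n).1) <= (p n).2.
  apply: (seq_lim_nm_le (N := n) ul) => m nm.
  by have := pnest n m nm; have [_] := pR m; lra.
have [x _ Tx] : range T l.
  by apply: (closed_seq_lim cT ul (N := 0)) => n _; have [] := pR n.
have [_ _ _ _ /(_ x)] := pS (Num.truncn (nm x)).+1.
move=> /(_ (ltW (truncnS_gt _))).
by rewrite Tx nmC ltNge => /negP; apply; exact: (ln (Num.truncn (nm x)).+2).
Qed.

(** Differences of the approximate preimages of [y0 + t y] and [y0], rescaled
    so that [t y] has norm [r / 2]. *)
Lemma range_approx : exists2 c : R, 0 < c &
  forall y, range T y -> forall e : R, 0 < e ->
    exists x, nm x <= c * nm y /\ nm (y - T x) < e.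
Proof.
have [n [y0 [r [Ry0 r0 hr]]]] := range_dense_ball.
have sR : subspace_set (range T) := subspace_image T (@subspace_setT _ X).
exists (4 * n.+1%:R / r) => [|y Ry e e0]; first by rewrite divr_gt0 // mulr_gt0.
have [->|y00] := eqVneq y 0.
  by exists 0; rewrite linear0 subrr !nm0 mulr0.
have ny := nm_gt0 y00; pose t := r / (2 * nm y).
have t0 : 0 < t by rewrite divr_gt0 // mulr_gt0.
have nt (V : normedModType R[i]) (v : V) : nm (t%:C *: v) = t * nm v.
  by rewrite nmZ nm_real gtr0_norm.
have te0 : 0 < t * e / 2 by rewrite divr_gt0 // mulr_gt0.
have [x1 [nx1 ex1]] := hr y0 Ry0 (ltac:(by rewrite subrr nm0)) _ te0.
have [||x2 [nx2 ex2]] := hr (t%:C *: y + y0) _ _ _ te0.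
- by apply: subZD.
- rewrite addrK nt /t; have -> : r / (2 * nm y) * nm y = r / 2.
    by field; rewrite gt_eqF.
  by lra.
have tC : t%:C != 0 by rewrite eq_complex /= eqxx andbT gt_eqF.
exists (t%:C^-1 *: (x2 - x1)); split.
  rewrite -(ler_pM2l t0) -nt scalerA mulfV // scale1r.
  have -> : t * (4 * n.+1%:R / r * nm y) = 2 * n.+1%:R.
    by rewrite /t; field; rewrite !gt_eqF.
  have := nmB x2 x1; have : n%:R <= n.+1%:R :> R by rewrite ler_nat.
  move: (n.+1%:R) (n%:R : R) nx1 nx2 => a b; lra.
have -> : T (t%:C^-1 *: (x2 - x1)) = t%:C^-1 *: (T x2 - T x1).
  by rewrite linearZ linearB.
rewrite -(ltr_pM2l t0) -nt scalerBr scalerA mulfV // scale1r.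
have -> : t%:C *: y - (T x2 - T x1) = (t%:C *: y + y0 - T x2) - (y0 - T x1).
  by rewrite !opprB [RHS]addrAC addrACA subrr addr0 addrA.
have := nmB (t%:C *: y + y0 - T x2) (y0 - T x1); lra.
Qed.

(** Successive approximation: the error is halved at each step, and the
    corrections form a geometric series. *)
Lemma open_mapping : exists2 c : R, 0 < c &
  forall y, range T y -> exists2 x, T x = y & nm x <= c * nm y.
Proof.
have [c c0 hc] := range_approx; exists (2 * c); first by rewrite mulr_gt0.
have sR : subspace_set (range T) := subspace_image T (@subspace_setT _ X).
move=> y Ry; have [->|y00] := eqVneq y 0.
  by exists 0; rewrite ?linear0 // !nm0 mulr0.
have ny := nm_gt0 y00; set d := nm y in ny.
have step (q : Y * R) : exists x, range T q.1 -> 0 < q.2 ->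
    nm x <= c * nm q.1 /\ nm (q.1 - T x) < q.2.
  have [h|h] := pselect (range T q.1 /\ 0 < q.2).
    by have [x hx] := hc _ h.1 _ h.2; exists x.
  by exists 0 => h1 h2; case: h.
have [g hg] := choice step.
have dk k : 0 < d * 2^-1 ^+ k by rewrite mulr_gt0 ?half_pow_gt0.
pose v := fix v n := if n is m.+1 then v m - T (g (v m, d * 2^-1 ^+ m.+1)) else y.
pose x n := g (v n, d * 2^-1 ^+ n.+1).
have vR n : range T (v n).
  by elim: n => [//|n IH] /=; apply: (subB sR) => //; exists (x n).
have hx n := hg (v n, d * 2^-1 ^+ n.+1) (vR n) (dk _).
have vd n : nm (v n) <= d * 2^-1 ^+ n.
  case: n => [|n] /=; first by rewrite expr0 mulr1.
  by have [_ /ltW] := hx n.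
have xd n : nm (x n) <= c * d * 2^-1 ^+ n.
  have [h _] := hx n; apply: le_trans h _; rewrite -mulrA.
  by rewrite ler_wpM2l ?vd // ltW.
pose s n := \sum_(0 <= i < n) x i.
have vE n : y - T (s n) = v n.
  elim: n => [|n IH]; first by rewrite /s big_geq // linear0 subr0.
  by rewrite /s big_nat_recr //= linearD /= opprD addrA IH.
have [||l [sl hl]] := @geometric_limit _ s (c * d) cX; first by rewrite mulr_gt0.
  by move=> n; rewrite /s big_nat_recr //= addrAC subrr add0r.
exists l; last first.
  by have := hl 0; rewrite /s big_geq // subr0 expr0 mulr1 mulrA.
have /bounded_opP [M M0 hM] := bT.
apply/eqP; rewrite eq_sym -subr_eq0; apply/eqP/nm_pos_eq0 => e e0.
have [|N hN] := half_pow_small (e := e / (d + M * (2 * (c * d)))).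
  by rewrite divr_gt0 // ltr_wpDr // !mulr_ge0 // ltW.
have := hN N (leqnn N); rewrite ltr_pdivlMr; last first.
  by rewrite ltr_wpDr // !mulr_ge0 // ltW.
have := nm_tri (T (s N)) y (T l); rewrite vE -linearB.
have := vd N; have := hM (s N - l); rewrite (nmC (s N)).
have : M * nm (l - s N) <= M * (2 * (c * d) * 2^-1 ^+ N).
  by rewrite ler_pM2l // hl.
nra.
Qed.
End OpenMapping.

(** * Closed ranges and non-compact operators *)

Section ClosedRanges.
Variable R : realType.

Lemma closed_kernel (X Y : normedModType R[i]) (T : {linear X -> Y}) :
  bounded_op T -> closed (T @^-1` [set 0]).
Proof. by move=> bT; exact: closed_preimage (@closed_set0 _ _). Qed.

Lemma subspace_kernel (X Y : normedModType R[i]) (T : {linear X -> Y}) :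
  subspace_set (T @^-1` [set 0]).
Proof. exact/subspace_preimage/subspace_set0. Qed.

Lemma subspace_range (X Y : normedModType R[i]) (T : {linear X -> Y}) :
  subspace_set (range T).
Proof. exact/subspace_image/subspace_setT. Qed.

Section Separable.
Variables (H : hilbertType R) (sepH : separable_space H).

(** A generator may be replaced by its component [u] orthogonal to the closed
    subspace [M] spanned so far; the coefficient on [u] is then a continuous
    function, so [M] plus the line of [u] is the preimage of [M] under a
    Lipschitz map. *)
Lemma closed_in_span (W : set H) s : subspace_set W -> closed W ->
  closed (in_span W s).
Proof.
move=> sW cW; elim: s => [//|b s IH].
have sM := in_span_subspace s sW; set M := in_span W s in IH sM.
have [P [_ PM Po]] := projection sepH sM IH; pose u := b - P b.
have Mu : perp M u by exact: Po.
have bE c v : M (v - c *: b) <-> M (v - c *: u).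
  have -> : v - c *: b = v - c *: u - c *: P b.
    by rewrite -addrA -opprD -scalerDr subrK.
  split=> h; last by apply: subB => //; exact: subZ.
  by rewrite -[_ - _](subrK (c *: P b)); apply: subD => //; exact: subZ.
have [u0|u0] := eqVneq u 0.
  rewrite (_ : in_span _ _ = M) //; apply/seteqP; split=> v /=.
    by move=> [c /bE]; rewrite u0 scaler0 subr0.
  by move=> Mv; exists 0; rewrite scale0r subr0.
have uu0 : ip u u != 0 by apply: contra u0 => /eqP/ip_eq0->.
pose g v := v - (ip v u / ip u u) *: u.
have -> : in_span W (b :: s) = g @^-1` M.
  apply/seteqP; split=> v /=; last by move=> h; exists (ip v u / ip u u); apply/bE.
  move=> [c /bE h]; rewrite /g (_ : ip v u / ip u u = c) //.
  have := ip_sym0 (Mu _ h); rewrite ipBl ipZl => /eqP; rewrite subr_eq0 => /eqP ->.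
  by rewrite mulfK.
apply: (@closed_preimage_lipschitz _ _ _ _ (1 + nm u / nm (ip u u) * nm u)) => // x y.
have -> : g x - g y = (x - y) - (ip (x - y) u / ip u u) *: u.
  by rewrite /g (ipBl x y) mulrBl scalerBl !opprD !opprK addrACA.
apply: le_trans (nmB _ _) _; rewrite mulrDl mul1r lerD2l nmZ nmM.
have -> : nm (ip u u)^-1 = (nm (ip u u))^-1.
  have n0 := nm_gt0 uu0; apply: (@mulIf _ (nm (ip u u))); first by rewrite gt_eqF.
  by rewrite -nmM !mulVf // ?gt_eqF // -[1]/(1%:C) nm_real normr1.
rewrite [leRHS]mulrAC ler_wpM2r ?nm_ge0 // [leRHS]mulrAC ler_wpM2r ?invr_ge0 ?nm_ge0 //.
by rewrite mulrC cauchy_schwarz.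
Qed.

(** Choose the preimage orthogonal to the kernel of [A]: uniqueness makes the
    choice linear, and the open mapping theorem makes it bounded. *)
Lemma douglas (X Y : normedModType R[i]) (A : {linear H -> Y}) (T : {linear X -> Y}) :
  seq_complete Y -> bounded_op A -> bounded_op T -> closed (range A) ->
  range T `<=` range A ->
  exists D : {linear X -> H}, bounded_op D /\ forall x, A (D x) = T x.
Proof.
move=> cY bA bT cA TA.
have sN : subspace_set (A @^-1` [set 0]) by exact: subspace_kernel.
have [P [bP PN Po]] := projection sepH sN (closed_kernel bA).
have uniq x x' : A x = A x' -> perp (A @^-1` [set 0]) x ->
    perp (A @^-1` [set 0]) x' -> x = x'.
  move=> xx' px px'; apply/eqP; rewrite -subr_eq0; apply/eqP.
  apply: (@perp_id _ _ (A @^-1` [set 0])); first by rewrite /= linearB xx' subrr.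
  exact: (subB (perp_subspace _)).
have AP x : A (x - P x) = A x by rewrite linearB (PN x) subr0.
have /choice [D hD] : forall x, exists h, A h = T x /\ perp (A @^-1` [set 0]) h.
  move=> x; have [|h _ hx] := TA (T x); first by exists x.
  by exists (h - P h); split; [rewrite AP|exact: Po].
have linD : linear D.
  move=> a x y; apply: uniq; [|exact: (hD _).2|].
    by rewrite linearP !(hD _).1 linearP.
  by apply: (subZD (perp_subspace _)); exact: (hD _).2.
exists (HB.pack D (GRing.isLinear.Build _ _ _ _ _ linD) : {linear X -> H}).
split=> [|x]; last exact: (hD x).1.
have [c c0 hc] := open_mapping (@complete_seq _ H) cY bA cA.
have /bounded_opP [M M0 hM] := bT; have /bounded_opP [M' M'0 hM'] := bP.
apply/bounded_opP; exists ((1 + M') * (c * M)).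
  by rewrite !mulr_gt0 // addr_gt0.
move=> x /=; have [|h hx hn] := hc (T x); first by apply: TA; exists x.
have -> : D x = h - P h by apply: uniq; rewrite ?AP ?hx ?(hD x).1 //; exact: (hD x).2.
apply: le_trans (nmB _ _) _; have := hM' h; have := hM x => k1 k2.
have : nm h <= c * (M * nm x) by apply: le_trans hn _; rewrite ler_pM2l.
have := nm_ge0 h; nra.
Qed.
End Separable.
End ClosedRanges.

Section NonCompact.
Variables (R : realType) (K L : hilbertType R) (B : {linear K -> L}).

Definition bounded_functional (g : K -> R[i]) :=
  (forall a x y, g (a *: x + y) = a * g x + g y) /\
  exists M : R, forall x, nm (g x) <= M * nm x.

Lemma functionalB g : bounded_functional g -> forall x y, g (x - y) = g x - g y.
Proof.
by move=> [hg _] x y; rewrite addrC -scaleN1r hg mulN1r addrC.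
Qed.

Lemma functionalZ g : bounded_functional g -> forall a x, g (a *: x) = a * g x.
Proof.
move=> [hg _]; have g0 : g 0 = 0.
  by have := hg (-1) 0 0; rewrite scaler0 addr0 mulN1r addNr.
by move=> a x; have := hg a x 0; rewrite addr0 g0 addr0.
Qed.

Lemma closed_functional g :
  bounded_functional g -> closed [set x | g x = 0].
Proof.
move=> bg; have [_ [M hM]] := bg; apply: (@closed_zeros _ _ _ _ M) => x y.
by rewrite -functionalB.
Qed.

Lemma functional_ip (w : L) : bounded_op B ->
  bounded_functional (fun x => ip (B x) w).
Proof.
move=> /bounded_opP [M M0 hM]; split=> [a x y|]; first by rewrite linearP ipDl ipZl.
exists (M * nm w) => x; apply: le_trans (cauchy_schwarz _ _) _.
by rewrite mulrAC ler_wpM2r ?nm_ge0.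
Qed.

Variable g : nat -> K -> R[i].

(** Induction on [n]: if the last functional is not zero on [G], a vector [e]
    of [G] where it equals 1 corrects any [x] into its kernel, at a cost
    proportional to the value of the functional at [x]. *)
Lemma bound_modulo_functionals (d : R) n (G : set K) :
  (forall i, (i < n)%N -> bounded_functional (g i)) -> 0 <= d -> subspace_set G ->
  (forall x, G x -> (forall i, (i < n)%N -> g i x = 0) -> nm (B x) <= d * nm x) ->
  exists2 k : R, 0 <= k & forall x, G x ->
    nm (B x) <= d * nm x + k * \sum_(0 <= i < n) nm (g i x).
Proof.
move=> bg d0; elim: n G bg => [|n IH] G bg sG hG.
  by exists 0 => // x Gx; rewrite mul0r addr0; exact: hG.
have bgn := bg n (ltnSn n).
pose G' := G `&` [set x | g n x = 0].
have sG' : subspace_set G'.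
  split; first by split; [exact: sub0|rewrite /= -(scale0r 0) functionalZ // mul0r].
  move=> a x y [Gx /= gx] [Gy /= gy]; split; first exact: subZD.
  by rewrite /= bgn.1 gx gy mulr0 addr0.
have [|//|x [Gx gx] hx|k k0 hk] := IH G'.
- by move=> i lin; apply: bg; exact: ltnW.
- apply: hG => // i; rewrite ltnS leq_eqVlt => /predU1P[->//|]; exact: hx.
have sum_ge0 x m : 0 <= \sum_(0 <= i < m) nm (g i x).
  by apply: sumr_ge0 => i _; exact: nm_ge0.
have [g0|/existsNP [e' /not_implyP [Ge' ge']]] :=
    pselect (forall x, G x -> g n x = 0).
  exists k => // x Gx; apply: le_trans (hk x _) _; first by split=> //; exact: g0.
  by rewrite lerD2l ler_wpM2l // big_nat_recr //= lerDl nm_ge0.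
pose e := (g n e')^-1 *: e'.
have Ge : G e by exact: subZ.
have ge : g n e = 1 by rewrite functionalZ // mulVf //; apply/eqP.
exists (k + d * nm e + k * \sum_(0 <= i < n) nm (g i e) + nm (B e)) => [|x Gx].
  by rewrite !addr_ge0 // ?mulr_ge0 ?nm_ge0.
pose t := g n x; pose x' := x - t *: e.
have Gx' : G' x'.
  split; first by apply: subB => //; exact: subZ.
  by rewrite /= functionalB // functionalZ // ge mulr1 subrr.
have h1 : nm (B x) <= nm (B x') + nm t * nm (B e).
  by rewrite -nmZ -linearZ; have := nmD (B x') (B (t *: e)); rewrite -linearD subrK.
have h2 : nm x' <= nm x + nm t * nm e by rewrite -nmZ; exact: nmB.
have h3 : \sum_(0 <= i < n) nm (g i x') <=
    \sum_(0 <= i < n) nm (g i x) + nm t * \sum_(0 <= i < n) nm (g i e).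
  rewrite mulr_sumr -big_split /= !big_nat; apply: ler_sum => i /andP[_ lin].
  have bi := bg i (ltnW lin); rewrite functionalB // functionalZ // -nmM.
  exact: nmB.
have h4 := hk x' Gx'.
rewrite big_nat_recr //= -/t.
have := nm_ge0 t; have := nm_ge0 e; have := nm_ge0 (B e).
have := sum_ge0 x n; have := sum_ge0 e n.
move: (\sum_(0 <= i < n) nm (g i x)) (\sum_(0 <= i < n) nm (g i e)) h3 h4
  => X E h3 h4 E0 X0 Be0 e0 t0.
have a1 : d * nm x' <= d * (nm x + nm t * nm e) by rewrite ler_wpM2l.
have a2 : k * \sum_(0 <= i < n) nm (g i x') <= k * (X + nm t * E) by rewrite ler_wpM2l.
have a3 : 0 <= (d * nm e + k * E + nm (B e)) * X.
  by rewrite mulr_ge0 // !addr_ge0 // mulr_ge0 // nm_ge0.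
nra.
Qed.
End NonCompact.

Section Pigeonhole.
Variables (R : realType) (K L : normedModType R[i]) (B : K -> L).

Lemma has_netU (E1 E2 : set L) (e : R) :
  has_net E1 e -> has_net E2 e -> has_net (E1 `|` E2) e.
Proof.
move=> [s hs] [t ht]; exists (s ++ t) => x [/hs|/ht] [y ys yx]; exists y => //;
  by rewrite mem_cat ys ?orbT.
Qed.

Lemma has_netS (E1 E2 : set L) (e : R) : E1 `<=` E2 -> has_net E2 e -> has_net E1 e.
Proof. by move=> E12 [s hs]; exists s => x /E12/hs. Qed.

(** Sort the points of [E] by the value of [h] rounded to a multiple of [eta].
    There are finitely many classes, and a finite union of sets whose images
    have a net has an image with a net. *)
Lemma no_net_refine (E : set K) (e : R) (h : K -> R) (M eta : R) :
  ~ has_net (B @` E) e -> 0 < eta -> (forall x, E x -> `|h x| <= M) ->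
  exists E', [/\ E' `<=` E, ~ has_net (B @` E') e &
    forall x y, E' x -> E' y -> `|h x - h y| <= eta].
Proof.
move=> nE eta0 hM; pose color x := Num.truncn ((h x + M) / eta).
pose Ec k := E `&` [set x | color x = k].
suff [k hk] : exists k, ~ has_net (B @` Ec k) e.
  exists (Ec k); split=> // [x []//|x y [Ex /= cx] [Ey /= cy]].
  have pos z : E z -> 0 <= (h z + M) / eta.
    by move=> /hM; rewrite ler_norml => /andP[? _]; rewrite divr_ge0 ?(ltW eta0) //; lra.
  have := truncn_itv (pos x Ex); have := truncn_itv (pos y Ey).
  rewrite -/(color x) -/(color y) cx cy -[k.+1%:R]natr1.
  rewrite !ler_pdivlMr // !ltr_pdivrMr // ler_norml => /andP[? ?] /andP[? ?].
  by apply/andP; split; nra.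
apply: contrapT => no; apply: nE.
have {}no k : has_net (B @` Ec k) e by apply: contrapT => nk; apply: no; exists k.
pose N := (Num.truncn ((M + M) / eta)).+1.
have colorN x : E x -> (color x < N)%N.
  move=> /hM; rewrite ler_norml => /andP[_ hx]; rewrite ltnS le_truncn //.
  by rewrite ler_pM2r ?invr_gt0 // lerD2r.
suff h' n : has_net (B @` (E `&` [set x | (color x < n)%N])) e.
  by apply: has_netS (h' N) => _ [x Ex <-]; exists x => //; split=> //; exact: colorN.
elim: n => [|n IH]; first by exists [::] => y [x [_ /=]].
apply: has_netS (has_netU IH (no n)) => y [x [Ex /=]].
by rewrite ltnS leq_eqVlt => /predU1P[xn|xn] <-; [right|left]; exists x.
Qed.
End Pigeonhole.

Section NonCompactSequence.
Variables (R : realType) (K L : hilbertType R) (B : {linear K -> L}).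

Lemma nm_le_ReIm (z : R[i]) : nm z <= `|complex.Re z| + `|complex.Im z|.
Proof.
rewrite {1}[z]complexE; apply: le_trans (nmD _ _) _.
rewrite nmM !nm_real; have -> : nm ('i%C : R[i]) = 1.
  by rewrite /nm normc_def /= expr0n /= add0r expr1n sqrtr1.
by rewrite mul1r.
Qed.

Lemma Re_le_nm (z : R[i]) : `|complex.Re z| <= nm z.
Proof. by rewrite -lecR -nmE normc_ge_Re. Qed.

Lemma Im_le_nm (z : R[i]) : `|complex.Im z| <= nm z.
Proof.
rewrite /nm normc_def /= -sqrtr_sqr ler_wsqrtr // lerDr sqr_ge0 //.
Qed.

Lemma no_net_functionals (E : set K) (e M eta : R) (g : nat -> K -> R[i]) n :
  (forall i, (i < n)%N -> bounded_functional (g i)) ->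
  ~ has_net (B @` E) e -> 0 < eta -> (forall x, E x -> nm x <= M) ->
  exists E', [/\ E' `<=` E, ~ has_net (B @` E') e &
    forall x y i, E' x -> E' y -> (i < n)%N -> nm (g i (x - y)) <= eta].
Proof.
move=> bg nE eta0 EM; elim: n bg => [|n IH] bg; first by exists E; split => // x y i _ _; rewrite ltn0.
have [|E1 [E1E nE1 E1g]] := IH; first by move=> i lin; apply: bg; exact: ltnW.
have bgn := bg n (ltnSn n); have [_ [C hC]] := bgn.
have gM x : E x -> nm (g n x) <= `|C| * `|M|.
  move=> Ex; apply: le_trans (hC x) _.
  apply: le_trans (_ : `|C| * nm x <= _); first by rewrite ler_wpM2r ?nm_ge0 ?ler_norm.
  by rewrite ler_wpM2l // (le_trans (EM x Ex)) ?ler_norm.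
have eta20 : 0 < eta / 2 by rewrite divr_gt0.
have [|E2 [E21 nE2 E2g]] := no_net_refine (h := fun x => complex.Re (g n x))
    (M := `|C| * `|M|) nE1 eta20.
  by move=> x /E1E /gM; apply: le_trans; exact: Re_le_nm.
have [|E3 [E32 nE3 E3g]] := no_net_refine (h := fun x => complex.Im (g n x))
    (M := `|C| * `|M|) nE2 eta20.
  by move=> x /E21 /E1E /gM; apply: le_trans; exact: Im_le_nm.
exists E3; split=> //; first by move=> x /E32/E21/E1E.
move=> x y i Ex Ey; rewrite ltnS leq_eqVlt => /predU1P[->|lin].
  rewrite functionalB //; apply: le_trans (nm_le_ReIm _) _.
  have := E2g _ _ (E32 _ Ex) (E32 _ Ey); have := E3g _ _ Ex Ey.
  by rewrite !raddfB /=; lra.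
by apply: E1g => //; [exact/E21/E32|exact/E21/E32].
Qed.

(** If [B] were bounded by [d] on the common kernel of the [g i], it would be
    controlled on the whole space by [d] and the values of the [g i]. Refine a
    bounded set [E] whose image has no finite [e]-net to a subset on which all
    [g i] are nearly constant: its image lies within [e] of one point, a
    contradiction. *)
Lemma noncompact_large_kernel : ~ compact_op B ->
  exists2 d : R, 0 < d & forall n (g : nat -> K -> R[i]),
    (forall i, (i < n)%N -> bounded_functional (g i)) ->
    exists x, [/\ forall i, (i < n)%N -> g i x = 0, nm x = 1 & d <= nm (B x)].
Proof.
move=> nB.
have [E [M EM [e e0 nE]]] : exists E, exists2 M : R, forall x, E x -> nm x <= M &
    exists2 e : R, 0 < e & ~ has_net (B @` E) e.
  apply: contrapT => no; apply: nB => E /bounded_setP [M EM].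
  apply: net_precompact => e e0; apply: contrapT => nE; apply: no.
  by exists E, M => //; exists e.
pose M1 := `|M| + 1; have M10 : 0 < M1 by rewrite ltr_wpDl.
have EM1 x : E x -> nm x <= M1.
  by move=> /EM h; apply: le_trans h _; have := ler_norm M; rewrite /M1; lra.
pose d := e / (4 * M1).
have d0 : 0 < d by rewrite divr_gt0 // mulr_gt0.
exists d => // n g bg; apply: contrapT => no.
have [//|||x _ hx|k k0 hk] := @bound_modulo_functionals _ _ _ B g d n setT.
- exact: ltW.
- exact: subspace_setT.
- have [->|x0] := eqVneq x 0; first by rewrite linear0 !nm0 mulr0.
  rewrite leNgt; apply/negP => hd; apply: no; have n0 := nm_gt0 x0.
  have [c c0 cx] := normalize x0; exists (c *: x); split=> //.
    by move=> i lin; rewrite functionalZ ?hx ?mulr0 //; exact: bg.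
  rewrite linearZ nmZ; move: cx; rewrite nmZ => cx.
  rewrite -[d]mulr1 -cx mulrCA ler_wpM2l ?nm_ge0 //; exact: ltW.
pose eta := e / (4 * (k + 1) * n.+1%:R).
have eta0 : 0 < eta by rewrite divr_gt0 // !mulr_gt0 // ltr_wpDl.
have [E' [E'E nE' gE']] := no_net_functionals bg nE eta0 EM1.
have [x Ex] : E' !=set0.
  apply/set0P/eqP => E'0; apply: nE'; rewrite E'0 image_set0.
  by exists [::] => x [].
apply: nE'; exists [:: B x] => _ [y Ey <-]; exists (B x); first exact: mem_head.
rewrite -linearB; apply: le_lt_trans (hk (x - y) Logic.I) _.
have s1 : d * nm (x - y) <= e / 2.
  apply: le_trans (_ : d * (2 * M1) <= _).
    rewrite ler_wpM2l ?(ltW d0) //; apply: le_trans (nmB _ _) _.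
    have := EM1 _ (E'E _ Ex); have := EM1 _ (E'E _ Ey); lra.
  rewrite /d; have -> : e / (4 * M1) * (2 * M1) = e / 2; last by [].
  by field; rewrite gt_eqF.
have s2 : k * \sum_(0 <= i < n) nm (g i (x - y)) <= e / 4.
  apply: le_trans (_ : (k + 1) * (n.+1%:R * eta) <= _).
    apply: ler_pM => //; first by apply: sumr_ge0 => i _; exact: nm_ge0.
      by rewrite lerDl.
    apply: le_trans (_ : \sum_(0 <= i < n) eta <= _).
      by rewrite !big_nat; apply: ler_sum => i /andP[_ lin]; exact: gE'.
    by rewrite sumr_const_nat subn0 -[eta *+ n]mulr_natl ler_wpM2r ?(ltW eta0) // ler_nat.
  rewrite /eta; have -> : (k + 1) * (n.+1%:R * (e / (4 * (k + 1) * n.+1%:R))) = e / 4; last by [].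
  field; rewrite addrC natr1 pnatr_eq0 /= gt_eqF //; lra.
lra.
Qed.

(** The vectors are chosen one after the other in the kernel of the functionals
    <., x_j> and <B ., B x_j>. Since both the vectors and their images are
    orthogonal, [B] is diagonal, and bounded below, on their closed span. *)
Lemma noncompact_sequence : bounded_op B -> ~ compact_op B ->
  exists2 d : R, 0 < d & exists x : nat -> K, [/\ orthonormal_seq x,
    forall i j, i != j -> ip (B (x i)) (B (x j)) = 0 &
    forall n, d <= nm (B (x n))].
Proof.
move=> bB /noncompact_large_kernel [d d0 hd]; exists d => //.
have /bounded_opP [M M0 hM] := bB.
pose P (s : seq K) x := [/\ nm x = 1, d <= nm (B x) &
  forall v, v \in s -> ip x v = 0 /\ ip (B x) (B v) = 0].
have /history_choice [x hx] : forall s, exists x, P s x.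
  (* even indices encode <., v> and odd ones <B ., B v> for v in s *)
  move=> s; pose g i (x : K) :=
    if odd i then ip (B x) (B s`_(i./2)) else ip x s`_(i./2).
  have [i _|x [gx x1 xd]] := hd (size s).*2 g.
    rewrite /g; case: odd; first exact: functional_ip.
    by apply: (@functional_ip _ _ _ idfun); exists 1 => y; rewrite mul1r.
  exists x; split=> // v /(nthP 0) [i li <-]; split.
    have := gx i.*2; rewrite /g odd_double doubleK; apply.
    by rewrite ltn_double.
  have := gx i.*2.+1; rewrite /g /= odd_double /= uphalf_double; apply.
  by rewrite ltn_Sdouble.
have prev m n : (m < n)%N -> ip (x n) (x m) = 0 /\ ip (B (x n)) (B (x m)) = 0.
  move=> mn; have [_ _] := hx n; apply; apply/mapP; exists m => //.
  by rewrite mem_iota.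
exists x; split=> [|i j|n]; last by have [] := hx n.
  apply: orthonormal_of_prev => [n|n m mn]; first by have [] := hx n.
  exact: (prev _ _ mn).1.
rewrite neq_ltn => /orP[ij|ji]; last exact: (prev _ _ ji).2.
by apply: ip_sym0; exact: (prev _ _ ij).2.
Qed.
End NonCompactSequence.

(** * Fredholm operators and isomorphisms of closed subspaces *)

Section BoundedMaps.
Variable R : realType.
Implicit Types X Y Z : normedModType R[i].

Definition bounded_map X Y (f : X -> Y) :=
  exists2 M : R, 0 <= M & forall x, nm (f x) <= M * nm x.

Lemma bounded_mapP X Y (T : {linear X -> Y}) : bounded_op T <-> bounded_map T.
Proof.
rewrite bounded_opP; split=> -[M M0 hM]; first by exists M => //; exact: ltW.
exists (M + 1) => [|x]; first by rewrite ltr_wpDl.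
by apply: le_trans (hM x) _; rewrite ler_wpM2r ?nm_ge0 // lerDl.
Qed.

Lemma bounded_map_comp X Y Z (f : X -> Y) (h : Y -> Z) :
  bounded_map h -> bounded_map f -> bounded_map (h \o f).
Proof.
move=> [M M0 hM] [N N0 hN]; exists (M * N) => [|x]; first exact: mulr_ge0.
by apply: le_trans (hM _) _; rewrite -mulrA ler_wpM2l.
Qed.

Lemma bounded_mapD X Y (f h : X -> Y) :
  bounded_map f -> bounded_map h -> bounded_map (fun x => f x + h x).
Proof.
move=> [M M0 hM] [N N0 hN]; exists (M + N) => [|x]; first exact: addr_ge0.
by apply: le_trans (nmD _ _) _; rewrite mulrDl lerD.
Qed.

Lemma bounded_mapB X Y (f h : X -> Y) :
  bounded_map f -> bounded_map h -> bounded_map (fun x => f x - h x).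
Proof.
move=> [M M0 hM] [N N0 hN]; exists (M + N) => [|x]; first exact: addr_ge0.
by apply: le_trans (nmB _ _) _; rewrite mulrDl lerD.
Qed.

Lemma bounded_map_id X : bounded_map (@id X).
Proof. by exists 1 => // x; rewrite mul1r. Qed.

Lemma bounded_map_fst X Y : bounded_map (@fst X Y).
Proof. by exists 1 => // z; rewrite mul1r; have [] := prod_nm z. Qed.

Lemma bounded_map_snd X Y : bounded_map (@snd X Y).
Proof. by exists 1 => // z; rewrite mul1r; have [] := prod_nm z. Qed.

Lemma bounded_map_pair X Y Z (f : X -> Y) (h : X -> Z) :
  bounded_map f -> bounded_map h -> bounded_map (fun x => (f x, h x)).
Proof.
move=> [M M0 hM] [N N0 hN]; exists (M + N) => [|x]; first exact: addr_ge0.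
have [_ _ /le_trans] := prod_nm (f x, h x); apply.
by rewrite mulrDl lerD ?hM ?hN.
Qed.

Fact pair_map_subproof X Y Z (f : {linear X -> Y}) (h : {linear X -> Z}) :
  linear (fun x => (f x, h x)).
Proof. by move=> a x y; rewrite (linearP f) (linearP h). Qed.

Definition pair_map X Y Z (f : {linear X -> Y}) (h : {linear X -> Z}) :
    {linear X -> (Y * Z)%type} :=
  HB.pack (fun x => (f x, h x))
    (GRing.isLinear.Build _ _ _ _ _ (pair_map_subproof f h)).

Lemma closed_preimage_bounded X Y (T : {linear X -> Y}) A :
  bounded_map T -> closed A -> closed (T @^-1` A).
Proof. by move=> /bounded_mapP; exact: closed_preimage. Qed.

Lemma bounded_block (H K : normedModType R[i]) (A : {linear H -> H})
    (B : {linear K -> K}) (C : {linear K -> H}) :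
  bounded_op A -> bounded_op B -> bounded_op C ->
  bounded_op (block_op A B C : {linear (H * K)%type -> (H * K)%type}).
Proof.
move=> /bounded_mapP bA /bounded_mapP bB /bounded_mapP bC; apply/bounded_mapP.
apply: bounded_map_pair; first apply: bounded_mapD.
- exact: bounded_map_comp bA (bounded_map_fst _ _).
- exact: bounded_map_comp bC (bounded_map_snd _ _).
- exact: bounded_map_comp bB (bounded_map_snd _ _).
Qed.
End BoundedMaps.

Section Fredholm.
Variable R : realType.

Lemma alpha_finP (X Y : normedModType R[i]) (T : {linear X -> Y}) :
  (alpha T < +oo)%E <-> fdim (T @^-1` [set 0]) [set 0].
Proof.
apply: dim_mod_finP; [exact: subspace_kernel|exact: subspace_set0|].
by move=> _ ->; rewrite /= linear0.
Qed.

Lemma beta_finP (X Y : normedModType R[i]) (T : {linear X -> Y}) :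
  (beta T < +oo)%E <-> fdim [set: Y] (range T).
Proof. by apply: dim_mod_finP => //; exact: subspace_range. Qed.

Lemma upper_semi_fredholmP (X Y : normedModType R[i]) (T : {linear X -> Y}) :
  upper_semi_fredholm T <-> closed (range T) /\ fdim (T @^-1` [set 0]) [set 0].
Proof. by rewrite /upper_semi_fredholm alpha_finP. Qed.

Lemma fredholm_fdim (X Y : normedModType R[i]) (T : {linear X -> Y}) :
  fdim (T @^-1` [set 0]) [set 0] -> fdim [set: Y] (range T) -> fredholm T.
Proof. by move=> /alpha_finP a /beta_finP b; split=> //; right. Qed.

(** The index is [-oo]. *)
Lemma upper_semi_weyl_inf (X Y : normedModType R[i]) (T : {linear X -> Y}) :
  closed (range T) -> fdim (T @^-1` [set 0]) [set 0] ->
  ~ fdim [set: Y] (range T) -> upper_semi_weyl T.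
Proof.
move=> cT fT nT; split; first exact/upper_semi_fredholmP.
rewrite /ind (_ : beta T = +oo%E); last first.
  by apply: dim_mod_inf => //; exact: subspace_range.
by move: fT => /alpha_finP; case: (alpha T).
Qed.

(** The range is the fixed space of [T \o S]. *)
Lemma left_invertible_usf (X Y : normedModType R[i]) (T : {linear X -> Y}) :
  bounded_op T -> left_invertible T -> upper_semi_fredholm T.
Proof.
move=> /bounded_mapP bT [S [/bounded_mapP bS ST]]; apply/upper_semi_fredholmP; split.
  have -> : range T = ((T \o S) \- idfun) @^-1` [set 0].
    apply/seteqP; split=> [_ [x _ <-]|y] /=; first by rewrite ST subrr.
    by move/eqP; rewrite subr_eq0 => /eqP h; exists (S y).
  apply: closed_preimage_bounded (@closed_set0 _ _) => /=.
  by apply: bounded_mapB; [exact: bounded_map_comp|exact: bounded_map_id].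
by exists [::] => x /= Tx; rewrite -(ST x) Tx linear0.
Qed.

(** [V] and [C] agree on the kernel of [G], which has finite codimension, and
    [V] maps the kernel of [C] into the range of [G]. *)
Lemma finite_rank_perturbation (X Y : normedModType R[i])
    (V C G : {linear X -> Y}) (V' : {linear Y -> X}) :
  cancel V V' -> cancel V' V -> fdim (range G) [set 0] ->
  (forall x, C x = V x - G x) -> fredholm C.
Proof.
move=> VK V'K fG CE; apply: fredholm_fdim.
  apply: fdimS (fdim_image V' fG); last by move=> _ [_ -> <-] /=; rewrite linear0.
  move=> x /=; rewrite CE => /eqP; rewrite subr_eq0 => /eqP VG.
  by exists (G x); [exists x|rewrite -VG VK].
have := fdim_image V (fdim_preimage (@subspace_setT _ X) (@subspace_set0 _ Y) fG).
apply: fdimS => [y _|_ [x [_ /= Gx] <-]]; first by exists (V' y).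
by exists x; rewrite // CE Gx subr0.
Qed.

Lemma dim_mod_iso (F : fieldType) (V V' : lmodType F) (f : {linear V -> V'})
    (h : {linear V' -> V}) (U W : set V) (U' W' : set V') :
  cancel f h -> cancel h f -> (forall x, U x <-> U' (f x)) ->
  (forall x, W x <-> W' (f x)) -> dim_mod U W = dim_mod U' W'.
Proof.
have main (V1 V2 : lmodType F) (f1 : {linear V1 -> V2})
    (h1 : {linear V2 -> V1}) (U1 W1 : set V1) (U2 W2 : set V2) n (b : 'I_n -> V1) :
    cancel h1 f1 -> (forall x, U1 x <-> U2 (f1 x)) ->
    (forall x, W1 x <-> W2 (f1 x)) -> basis_mod U1 W1 b -> basis_mod U2 W2 (f1 \o b).
  move=> hK hU hW [Ub hb]; split=> [i|v Uv]; first exact/hU.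
  have sE (c : 'rV_n) : W1 (h1 v - \sum_(i < n) c ord0 i *: b i) <->
      W2 (v - \sum_(i < n) c ord0 i *: (f1 \o b) i).
    rewrite hW linearB hK linear_sum.
    by under eq_bigr do rewrite linearZ /=.
  have [|c [hc uc]] := hb (h1 v); first by apply/hU; rewrite hK.
  exists c; split; first exact/sE.
  by move=> d /sE; exact: uc.
move=> fK hK hU hW; rewrite /dim_mod; congr xget.
apply/seteqP; split=> _ [n [b hb] <-]; exists n => //.
  by exists (f \o b); apply: main hb.
exists (h \o b); apply: main hb => // x; first by rewrite hU hK.
by rewrite hW hK.
Qed.
End Fredholm.

Section Isomorphisms.
Variables (R : realType).

(** [U] is a partial map from [M] to [N], extended by 0 on the complement of
    [M], and [U'] inverts it on [M]; used together with its mirror image. *)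
Definition half_iso (H K : hilbertType R) (M : set K) (N : set H)
    (U : {linear K -> H}) (U' : {linear H -> K}) :=
  [/\ bounded_op U, forall x, N (U x), forall x, M x -> U' (U x) = x &
      forall x, perp M x -> U x = 0].

Lemma closed_iso (H K : hilbertType R) (M : set K) (N : set H) :
  separable_space H -> separable_space K ->
  subspace_set M -> closed M -> ~ fdim M [set 0] ->
  subspace_set N -> closed N -> ~ fdim N [set 0] ->
  exists U U', half_iso M N U U' /\ half_iso N M U' U.
Proof.
move=> sepH sepK sM cM iM sN cN iN.
have [e eM] := infinite_basis sepK sM cM iM.
have [f fN] := infinite_basis sepH sN cN iN.
have [U [bU NU Uf oU]] := basis_transfer sM cM sN cN eM fN.
have [U' [bU' MU' U'e oU']] := basis_transfer sN cN sM cM fN eM.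
case: eM fN => _ _ eM [_ _ fN].
exists U, U'; split; split=> // x Mx; apply/eqP; rewrite -subr_eq0; apply/eqP.
  apply: (perp_id (W := M)); first exact: subB.
  by apply: eM => n; rewrite ipBl U'e Uf subrr.
apply: (perp_id (W := N)); first exact: subB.
by apply: fN => n; rewrite ipBl Uf U'e subrr.
Qed.

Lemma perp_perp (H : hilbertType R) (W : set H) x : W x -> perp (perp W) x.
Proof. by move=> Wx y /(_ _ Wx); exact: ip_sym0. Qed.

(** Sum of an isomorphism from [L] to [N] and one between their complements,
    each extended by 0. *)
Lemma matched_iso (H K : hilbertType R) (L : set K) (N : set H) :
  separable_space H -> separable_space K ->
  subspace_set L -> closed L -> ~ fdim L [set 0] -> ~ fdim (perp L) [set 0] ->
  subspace_set N -> closed N -> ~ fdim N [set 0] -> ~ fdim (perp N) [set 0] ->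
  exists (C : {linear K -> H}) (C' : {linear H -> K}),
    [/\ bounded_op C /\ bounded_op C', cancel C C', cancel C' C,
      (forall x, L x -> N (C x)) /\ (forall x, perp L x -> perp N (C x)) &
      (forall y, N y -> L (C' y)) /\ (forall y, perp N y -> perp L (C' y))].
Proof.
move=> sepH sepK sL cL iL iL' sN cN iN iN'.
have [U1 [V1 [[bU1 NU1 V1K oU1] [bV1 LV1 U1K oV1]]]] :=
  closed_iso sepH sepK sL cL iL sN cN iN.
have [U2 [V2 [[bU2 NU2 V2K oU2] [bV2 LV2 U2K oV2]]]] :=
  closed_iso sepH sepK (perp_subspace L) (@perp_closed _ _ L) iL'
    (perp_subspace N) (@perp_closed _ _ N) iN'.
have [P [_ PL Po]] := projection sepK sL cL.
have [Q [_ QN Qo]] := projection sepH sN cN.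
pose C : {linear K -> H} := U1 \+ U2; pose C' : {linear H -> K} := V1 \+ V2.
have UL x : L x -> C x = U1 x.
  by move=> Lx; rewrite /C /= oU2 ?addr0 //; exact: perp_perp.
have UL' x : perp L x -> C x = U2 x.
  by move=> Lx; rewrite /C /= oU1 ?add0r.
have VN x : N x -> C' x = V1 x.
  by move=> Nx; rewrite /C' /= oV2 ?addr0 //; exact: perp_perp.
have VN' x : perp N x -> C' x = V2 x.
  by move=> Nx; rewrite /C' /= oV1 ?add0r.
exists C, C'; split.
- split; apply/bounded_mapP; apply: bounded_mapD; exact/bounded_mapP.
- move=> x; have -> : C x = U1 (P x) + U2 (x - P x).
    by rewrite -{1}(subrKC (P x) x) (linearD C) UL // UL'.
  by rewrite (linearD C') VN // VN' // V1K // V2K // subrKC.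
- move=> x; have -> : C' x = V1 (Q x) + V2 (x - Q x).
    by rewrite -{1}(subrKC (Q x) x) (linearD C') VN // VN'.
  by rewrite (linearD C) UL // UL' // U1K // U2K // subrKC.
- by split=> x h; [rewrite UL|rewrite UL'].
- by split=> x h; [rewrite VN|rewrite VN'].
Qed.

(** The coordinates along [e], used as coordinates in an orthonormal basis of
    [K], give a map from [U] onto [K] which kills [W]. *)
Lemma orthonormal_inf (V K : hilbertType R) (e : nat -> V) (U W : set V) :
  separable_space K -> ~ fdim [set: K] [set 0] ->
  orthonormal_seq e -> subspace_set U -> closed U -> (forall n, U (e n)) ->
  (forall w n, W w -> ip w (e n) = 0) -> ~ fdim U W.
Proof.
move=> sepK iK oe sU cU Ue We.
have [k [ok _ kK]] := infinite_basis sepK (@subspace_setT _ K) closedT iK.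
have one (n : nat) : nm (1 : R[i]) <= 1.
  have -> : (1 : R[i]) = 1%:C by []; by rewrite nm_real normr1.
have [T [_ Te _]] := fourier_multiplier (b := fun=> 1) (M := 1)
  (orthonormal_sub oe) (orthonormal_sub ok) one.
have [S [_ Sk SU]] := fourier_multiplier (b := fun=> 1) (M := 1)
  (orthonormal_sub ok) (orthonormal_sub oe) one.
have TE x n : ip (T x) (k n) = ip x (e n) by rewrite Te ok eqxx mul1r mulr1.
have SE y n : ip (S y) (e n) = ip y (k n) by rewrite Sk oe eqxx mul1r mulr1.
have k0 y : (forall n, ip y (k n) = 0) -> y = 0.
  by move=> /kK h; apply: (perp_id (W := setT)).
move=> /(fdim_image T) fU; apply: iK; apply: fdimS fU => [y _|_ [w Ww <-] /=].
  exists (S y); first exact: SU.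
  apply/eqP; rewrite -subr_eq0; apply/eqP/k0 => n.
  by rewrite ipBl TE SE subrr.
by apply: k0 => n; rewrite TE We.
Qed.

(** Split the sequence on which [B] is diagonal into its even part, spanning
    [L], and its odd part. The odd vectors witness that the complement of [L]
    is infinite dimensional, and their images, orthogonal to [B L], that [B L]
    has infinite codimension. The inverse [B'] is the multiplier sending
    [B (l n)] back to [l n]. *)
Lemma noncompact_splitting (K : hilbertType R) (B : {linear K -> K}) :
  separable_space K -> ~ fdim [set: K] [set 0] -> bounded_op B ->
  ~ compact_op B ->
  exists (L : set K) (B' : {linear K -> K}),
    [/\ subspace_set L /\ closed L,
      ~ fdim L [set 0] /\ ~ fdim (perp L) [set 0],
      bounded_op B', (forall y, L (B' y)) /\ (forall x, L x -> B' (B x) = x) &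
      ~ fdim [set: K] (B @` L)].
Proof.
move=> sepK iK bB nB.
have [d d0 [x [ox Bo Bd]]] := noncompact_sequence bB nB.
have nB0 n : 0 < nm (B (x n)) by exact: lt_le_trans (Bd n).
pose l n := x n.*2; pose l' n := x n.*2.+1.
pose f n := ((nm (B (x n)))^-1)%:C *: B (x n).
have of_ : orthonormal_seq f.
  move=> i j; rewrite /f ipZl ipZr; have [->|ij] := eqVneq i j; last first.
    by rewrite Bo // !mulr0.
  rewrite ip_nm conj_realC -!rmorphM /= -[RHS]/(1%:C); congr (_%:C).
  by move: (nB0 j); move: (nm _) => t t0; field; rewrite gt_eqF.
have ol : orthonormal_seq l.
  by move=> i j; rewrite ox; congr (nat_of_bool _)%:R; rewrite -!muln2 eqn_pmul2r.
have ol' : orthonormal_seq l'.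
  by move=> i j; rewrite ox eqSS; congr (nat_of_bool _)%:R; rewrite -!muln2 eqn_pmul2r.
have neq i j : j.*2.+1 != i.*2.
  by apply/eqP => /(congr1 odd); rewrite /= !odd_double.
have ofl : orthonormal_seq (fun n => f n.*2).
  by move=> i j; rewrite of_; congr (nat_of_bool _)%:R; rewrite -!muln2 eqn_pmul2r.
have ofl' : orthonormal_seq (fun n => f n.*2.+1).
  by move=> i j; rewrite of_ eqSS; congr (nat_of_bool _)%:R; rewrite -!muln2 eqn_pmul2r.
pose L := perp [set v | forall n, ip v (l n) = 0].
have sL : subspace_set L := perp_subspace _.
have cL : closed L := @perp_closed _ _ _.
have Ll n : L (l n) by move=> v /(_ n); exact: ip_sym0.
have Lz v : L v -> (forall n, ip v (l n) = 0) -> v = 0.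
  by move=> Lv h; apply: (perp_id (W := L)) => // w /(_ _ h); exact: ip_sym0.
have Lfun g : bounded_functional g -> (forall n, g (l n) = 0) ->
    forall v, L v -> g v = 0.
  move=> bg gl v Lv; pose N := [set v | g v = 0].
  have sN : subspace_set N.
    split; first by rewrite /N /= -(scale0r 0) functionalZ // mul0r.
    by move=> a u w; rewrite /N /= => gu gw; rewrite bg.1 gu gw mulr0 addr0.
  have [P [_ PN Po]] := projection sepK sN (closed_functional bg).
  suff -> : v = P v by exact: PN.
  apply/eqP; rewrite -subr_eq0; apply/eqP/ip_eq0.
  have h : forall n, ip (v - P v) (l n) = 0 by move=> n; apply: Po; exact: gl.
  have h' := Po v _ (PN v); rewrite ipBr h' subr0.
  by apply: ip_sym0; exact: Lv.
pose g n v := ip (B v) (B (l n)) - (nm (B (l n)) ^+ 2)%:C * ip v (l n).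
have LZ n v : L v -> g n v = 0.
  have bg : bounded_functional (g n).
    split=> [a u w|]; first by rewrite /g linearP !ipDl !ipZl; ring.
    have /bounded_opP [M M0 hM] := bB.
    exists (M * nm (B (l n)) + nm (B (l n)) ^+ 2 * nm (l n)) => u.
    apply: le_trans (nmB _ _) _; rewrite mulrDl; apply: lerD.
      apply: le_trans (cauchy_schwarz _ _) _.
      by rewrite mulrAC ler_wpM2r ?nm_ge0.
    rewrite nmM nm_real ger0_norm ?sqr_ge0 // -mulrA ler_wpM2l ?sqr_ge0 //.
    by rewrite mulrC cauchy_schwarz.
  apply: Lfun => // m.
  rewrite /g /l; have [->|mn] := eqVneq m n.
    by rewrite ip_nm ox eqxx mulr1 subrr.
  have mn2 : m.*2 != n.*2 by rewrite -!muln2 eqn_pmul2r.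
  by rewrite Bo // ox (negPf mn2) mulr0 subrr.
have bM n : nm (((nm (B (l n)))^-1)%:C) <= d^-1.
  by rewrite nm_real ger0_norm ?invr_ge0 ?nm_ge0 // lef_pV2 ?posrE ?Bd ?nB0.
have [B' [bB' B'l B'L]] := fourier_multiplier (orthonormal_sub ofl) (orthonormal_sub ol) bM.
have LB' y : L (B' y) by exact: (B'L L).
have B'K v : L v -> B' (B v) = v.
  move=> Lv; apply/eqP; rewrite -subr_eq0; apply/eqP/Lz; first exact: (subB sL).
  move=> n; rewrite ipBl B'l ol eqxx mulr1 /f ipZr conj_realC mulrA -rmorphM /=.
  have /eqP := LZ n v Lv; rewrite subr_eq0 => /eqP ->.
  rewrite mulrA -rmorphM /= -/(l n).
  have -> : (nm (B (l n)))^-1 * (nm (B (l n)))^-1 * nm (B (l n)) ^+ 2 = 1.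
    by move: (nB0 n.*2); rewrite -/(l n); move: (nm _) => t t0; field; rewrite gt_eqF.
  by rewrite mul1r subrr.
have Ll' n : perp L (l' n).
  move=> v Lv; apply: ip_sym0.
  by apply: Lv => m; rewrite ox (negPf (neq _ _)).
exists L, B'; split=> //.
- split.
    apply: (orthonormal_inf sepK iK ol) => // w n ->; exact: ip0l.
  apply: (orthonormal_inf sepK iK ol') => //; [exact: perp_subspace|
    exact: perp_closed|by move=> w n ->; exact: ip0l].
- apply: (orthonormal_inf sepK iK ofl') => // _ n [v Lv <-].
  rewrite /f ipZr; suff -> : ip (B v) (B (x n.*2.+1)) = 0 by rewrite mulr0.
  apply: (Lfun (fun v => ip (B v) (B (x n.*2.+1)))) => // [|m].
    exact: functional_ip.
  by apply: Bo; rewrite eq_sym.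
Qed.
End Isomorphisms.

(** * Completions of block operators *)

Section BlockOperators.
Variables (R : realType) (H K : hilbertType R).
Hypotheses (sepH : separable_space H) (sepK : separable_space K).
Hypotheses (infH : ~ fdim [set: H] [set 0]) (infK : ~ fdim [set: K] [set 0]).
Variables (A : {linear H -> H}) (B : {linear K -> K}).
Hypotheses (bA : bounded_op A) (bB : bounded_op B).

Local Notation M C := (block_op A B C : {linear (H * K)%type -> (H * K)%type}).
Local Notation ker T := (T @^-1` [set 0]).

Lemma fdim_closed (F : set K) : subspace_set F -> fdim F [set 0] -> closed F.
Proof.
move=> sF fF; have z0 : [set 0] `<=` F by move=> _ ->; exact: sub0.
have [n [b [Fb hb]]] := fdim_basis sF (@subspace_set0 _ K) z0 fF.
have -> : F = in_span [set 0] [seq b i | i <- enum 'I_n].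
  apply/seteqP; split=> [v /hb [c [vc _]]|v].
    by apply: (@in_span_sum _ _ _ _ _ b (fun i => c ord0 i)); rewrite big_enum.
  elim: (enum _) v => [|i r IH] v /=; first exact: z0.
  move=> [c /IH h]; rewrite -(subrK (c *: b i) v).
  by apply: subD => //; exact: subZ.
by apply: (closed_in_span sepK); [exact: subspace_set0|exact: closed_set0].
Qed.

Lemma complete_block : seq_complete (H * K)%type.
Proof. by apply: complete_prod; exact: complete_seq. Qed.

(** The kernel of [A] embeds in the kernel of [M C]. If [A x_i] tends to [h],
    then [(h, 0) = M C (x, y)] by closedness; the open mapping theorem for
    [M C] shows that [y] is a limit of second components of kernel vectors.
    These form a finite dimensional, hence closed, subspace [F], so a kernel
    vector [(x'', y)] exists and [h = A (x - x'')]. *)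
Lemma block_usf_left C : bounded_op C -> upper_semi_fredholm (M C) ->
  closed (range A) /\ fdim (ker A) [set 0].
Proof.
move=> bC /upper_semi_fredholmP [cM fM]; split; last first.
  have := fdim_image fst fM; apply: fdimS => [x /= Ax|_ [_ -> <-] //].
  by exists (x, 0) => //=; rewrite /block_op /= Ax !linear0 addr0.
have [c c0 hc] := open_mapping complete_block complete_block (bounded_block bA bB bC) cM.
pose F := snd @` ker (M C).
have sF : subspace_set F by apply: subspace_image; exact: subspace_kernel.
have cF : closed F.
  apply: fdim_closed => //; have := fdim_image snd fM.
  by apply: fdimS => // _ [_ -> <-].
apply/closed_epsP => h hh.
have [[x y] _ [Axy By]] : range (M C) (h, 0).
  apply: (closed_epsP _).1 => // e e0; have [_ [x _ <-] hx] := hh e e0.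
  exists (A x, 0).
    by exists (x, 0) => //; rewrite /= /block_op /= !linear0 addr0.
  have [_ _ /le_lt_trans] := prod_nm ((h, 0) - (A x, 0) : H * K); apply.
  by rewrite /= subrr nm0 addr0.
have Fy : F y.
  apply: (closed_epsP _).1 => // e e0.
  have [|_ [x' _ <-] hx'] := hh (e / c); first exact: divr_gt0.
  have [|z Mz nz] := hc (M C (x - x', y)); first by exists (x - x', y).
  exists (y - z.2).
    exists ((x - x', y) - z) => //=.
    by have := linearB (M C) (x - x', y) z; rewrite Mz subrr.
  rewrite opprB addrC subrK; have [_ n2 _] := prod_nm z; apply: le_lt_trans n2 _.
  apply: le_lt_trans nz _; rewrite mulrC -ltr_pdivlMr //.
  have -> : M C (x - x', y) = (h - A x', 0).
    by rewrite /= /block_op /= linearB -Axy -By; congr pair; rewrite addrAC.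
  have [_ _ /le_lt_trans] := prod_nm (h - A x', 0 : K); apply.
  by rewrite /= nm0 addr0.
have [[x'' y'] /= [Axy'' _] /= yy'] := Fy; exists (x - x'') => //.
by rewrite linearB -Axy -yy' -[RHS]subr0 -Axy'' opprD addrACA subrr addr0.
Qed.

(** Let [N] be the space of the [(x, y)] with [A x + C y = 0]. Since the range
    of [C] has finite codimension, [N] is infinite dimensional, and so is the
    space of the [B y] for [(x, y)] in [N], as [M C] has finite dimensional
    kernel. An orthonormal sequence of that space lifts, by the open mapping
    theorem, to a bounded sequence of vectors [y], which contradicts the
    compactness of [B]. *)
Lemma fredholm_compact_not_usf C : Phi K H C -> compact_op B ->
  ~ upper_semi_fredholm (M C).
Proof.
move=> [bC [_ _ /beta_finP fC]] cB /upper_semi_fredholmP [cM fM].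
have [c c0 hc] := open_mapping complete_block complete_block (bounded_block bA bB bC) cM.
pose N := M C @^-1` [set w | w.1 = 0].
have sN : subspace_set N.
  apply: subspace_preimage; split=> //= a x y -> ->.
  by rewrite scaler0 addr0.
pose B2 : {linear (H * K)%type -> K} := B \o snd.
have infW : ~ fdim (B2 @` N) [set 0].
  move=> /(fdim_preimage sN (@subspace_set0 _ K)) fN; apply: infH.
  have {}fN : fdim N [set 0].
    apply: fdim_trans fM; apply: fdimS fN => // -[x y] [/= Nxy Bxy].
    by rewrite /= /block_op /=; congr pair.
  have fG : fdim (fst @` N) [set 0 : H].
    by have := fdim_image fst fN; apply: fdimS => // _ [_ -> <-].
  apply: fdim_trans fG.
  have := @fdim_preimage _ _ _ A setT (range C) (@subspace_setT _ H) (subspace_range C).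
  move=> /(_ (fdimS _ _ fC)) fA; apply: fdimS (fA _ _) => // x [_ /= [y _ Cy]].
  by exists (x, - y) => //; rewrite /N /= /block_op /= linearN Cy subrr.
have [w [ow Ww]] := inf_orthonormal (subspace_image B2 sN) infW.
pose E := [set y : K | nm y <= c].
have bE : bounded_set E by apply/bounded_setP; exists c.
have wE n : (B @` E) (w n).
  have [[x y] Nxy wn] := Ww n.
  have [|z Mz nz] := hc (0, w n).
    exists (x, y) => //; move: Nxy wn; rewrite /N /B2 /= /block_op /= => -> <- //.
  exists z.2; last by move: Mz; rewrite /= /block_op /= => -[].
  have [_ n2 _] := prod_nm z; apply: le_trans n2 (le_trans nz _).
  rewrite -[leRHS]mulr1 ler_wpM2l ?(ltW c0) //.
  have [_ _ /le_trans] := prod_nm (0 : H, w n); apply; rewrite /= nm0 add0r.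
  by rewrite suborthonormal_nm ?orthonormal_neq0 //; exact: orthonormal_sub.
have [m [n [mn wmn]]] := precompact_pair (cB E bE) wE ltr01.
have := pythagoras (x := w m) (y := - w n).
rewrite ipNr ow (negPf mn) oppr0 => /(_ erefl); rewrite nmN.
rewrite !suborthonormal_nm ?orthonormal_neq0 ?expr1n //; try exact: orthonormal_sub.
move: wmn; have := nm_ge0 (w m - w n); nra.
Qed.

Section InfiniteCorank.
Hypotheses (cA : closed (range A)) (fA : fdim (ker A) [set 0]).
Hypotheses (nA : ~ fdim [set: H] (range A)) (nB : ~ compact_op B).

(** [C] is an isomorphism matching [L] with the range of [A] and their
    complements with each other, where [B] is bounded below on [L] and [B L]
    has infinite codimension. From [(h, k) = (A x + C y, B y)] one recovers
    first the component of [y] outside [L], from the component of [h] outside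
    the range of [A]; then the component of [y] in [L], from [k]; and finally
    [A x]. *)
Lemma infinite_corank_completion : exists C : {linear K -> H}, [/\ Phi K H C,
  upper_semi_weyl (M C) & left_invertible A -> left_invertible (M C)].
Proof.
have [L [B' [[sL cL] [iL iL'] bB' [LB' B'K] nBL]]] :=
  noncompact_splitting sepK infK bB nB.
pose N := range A; have sN : subspace_set N by exact: subspace_range.
have [P [bP PN Po]] := projection sepH sN cA.
have [PL [bPL PLL PLo]] := projection sepK sL cL.
have iN : ~ fdim N [set 0].
  move=> fN; apply: infH; apply: fdim_trans fA.
  have := fdim_preimage (@subspace_setT _ H) (@subspace_set0 _ H) fN.
  by apply: fdimS => // x [].
have iN' : ~ fdim (perp N) [set 0].
  move=> [s hs]; apply: nA; exists s => v _.
  apply: (in_span_shift sN _ (PN v)); last by apply: hs; exact: Po.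
  by move=> _ ->; exact: sub0.
have [C [C' [[bC bC'] CK C'K [CN CN'] [C'L C'L']]]] :=
  matched_iso sepH sepK sL cL iL iL' sN cA iN iN'.
exists C.
(* the projection on the complement of the range of A *)
pose Q : {linear H -> H} := idfun \- P.
have Qo h : perp N (Q h) by exact: Po.
have QN h : N h -> Q h = 0.
  move=> Nh; apply: (perp_id (W := N)) => //=; exact: subB.
have Q_id h : perp N h -> Q h = h.
  move=> oh; apply/eqP; rewrite -subr_eq0 /= addrC addKr oppr_eq0; apply/eqP.
  apply: (perp_id (W := N)) => //.
  rewrite -[P h](subKr h); apply: (subB (perp_subspace _)) => //; exact: Po.
(* recovers the component of y outside L *)
pose D : {linear H -> K} := C' \o Q.
have Dblock x y : D (A x + C y) = y - PL y.
  have -> : D (A x + C y) = C' (Q (A x) + Q (C (PL y)) + Q (C (y - PL y))).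
    rewrite -[LHS]/(C' (Q (A x + C y))) -addrA -(linearD Q) -(linearD C).
    by rewrite subrKC -(linearD Q).
  rewrite QN; last by exists x.
  rewrite QN; last exact: CN.
  by rewrite Q_id ?add0r ?CK //; exact: CN'.
have DL' h : C (D h) = Q h by rewrite /D /= C'K.
have bQ : bounded_map Q.
  by apply: bounded_mapB; [exact: bounded_map_id|exact/bounded_mapP].
have bD : bounded_map D.
  by apply: bounded_map_comp => //; exact/bounded_mapP.
(* recovers the image under B of the component of y in L *)
pose G : {linear (H * K)%type -> K} := snd \- (B \o D \o fst).
have bG : bounded_map G.
  apply: bounded_mapB; first exact: bounded_map_snd.
  apply: bounded_map_comp (bounded_map_fst _ _).
  by apply: bounded_map_comp bD; exact/bounded_mapP.
have GM z : G (M C z) = B (PL z.2).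
  by rewrite /G /= /block_op /= -[B (D _)]/(B (D (A z.1 + C z.2))) Dblock linearB subKr.
have BL_range : B @` L = (B \o B' \- idfun) @^-1` [set 0].
  apply/seteqP; split=> [_ [x Lx <-]|y] /=; first by rewrite B'K // subrr.
  by move/eqP; rewrite subr_eq0 => /eqP h; exists (B' y).
have cBL : closed (B @` L).
  rewrite BL_range; apply: closed_preimage_bounded (@closed_set0 _ _).
  apply: bounded_mapB; last exact: bounded_map_id.
  by apply: bounded_map_comp; exact/bounded_mapP.
have rangeM : range (M C) = G @^-1` (B @` L).
  apply/seteqP; split=> [_ [z _ <-]|[h k]].
    by exists (PL z.2) => //; rewrite GM.
  move=> [a La Ba]; have [x _ Ax] : N (P h - C a).
    by apply: subB => //; exact: CN.
  exists (x, a + D h) => //; rewrite /= /block_op /= Ax (linearD C) (linearD B) DL'.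
  congr pair; first by rewrite addrA subrK /Q /= subrKC.
  by rewrite Ba /G /= subrK.
have kerM z : M C z = 0 -> A z.1 = 0 /\ z.2 = 0.
  move=> Mz; have z2 : z.2 = 0.
    have yL : PL z.2 = 0 by rewrite -(B'K _ (PLL _)) -GM Mz !linear0.
    have := Dblock z.1 z.2; have [-> _] : A z.1 + C z.2 = 0 /\ B z.2 = 0.
      by move: Mz => /= [].
    by rewrite linear0 yL subr0.
  by split=> //; move: Mz => /= []; rewrite z2 linear0 addr0.
split.
- split; first exact: bC.
  apply: (@finite_rank_perturbation _ _ _ C C \0 C') => //; last by move=> x; rewrite subr0.
  by exists [::] => _ [x _ <-].
- apply: upper_semi_weyl_inf.
  + by rewrite rangeM; exact: closed_preimage_bounded.
  + pose j : {linear H -> (H * K)%type} := pair_map idfun \0.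
    have := fdim_image j fA; apply: fdimS => [z /kerM [Az z2]|_ [_ -> <-] //].
    by exists z.1 => //=; rewrite -z2; case: z {Az z2}.
  + pose j : {linear K -> (H * K)%type} := pair_map \0 idfun.
    move=> fM; apply: nBL.
    have fj : fdim (j @` setT) (range (M C)).
      exact: (@fdimS _ _ setT _ (range (M C))) fM.
    have sR : subspace_set (range (M C)) by exact: subspace_range.
    have h := fdim_preimage (@subspace_setT _ K) sR fj.
    apply: fdimS h => // y.
    case=> _.
    rewrite rangeM => -[a La Ba]; exists a; rewrite // Ba.
    by rewrite -[LHS]/(y - B (D 0)) (linear0 D) (linear0 B) subr0.
- move=> [A' [bA' A'K]].
  pose y : {linear (H * K)%type -> K} := (B' \o G) \+ (D \o fst).
  pose x : {linear (H * K)%type -> H} := A' \o (fst \- (C \o y)).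
  exists (pair_map x y).
  have bdy : bounded_map y.
    apply: bounded_mapD; last exact: bounded_map_comp bD (bounded_map_fst _ _).
    by apply: bounded_map_comp bG; exact/bounded_mapP.
  split.
    apply/bounded_mapP; apply: (bounded_map_pair _ bdy).
    apply: bounded_map_comp; first exact/bounded_mapP.
    apply: bounded_mapB; first exact: bounded_map_fst.
    by apply: bounded_map_comp bdy; exact/bounded_mapP.
  move=> z.
  have yE : y (M C z) = z.2.
    rewrite -[LHS]/(B' (G (M C z)) + D (A z.1 + C z.2)) GM Dblock B'K //.
    by rewrite subrKC.
  have xE : x (M C z) = z.1.
    by rewrite -[LHS]/(A' (A z.1 + C z.2 - C (y (M C z)))) yE addrK A'K.
  rewrite -[LHS]/(x (M C z), y (M C z)) xE yE; by case: z {xE yE}.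
Qed.
End InfiniteCorank.

Section FiniteCorank.
Variable C0 : {linear K -> H}.
Hypotheses (bC0 : bounded_op C0) (cA : closed (range A)).
Hypothesis fA : fdim [set: H] (range A).

(** For bounded [D], [M (C0 + A D)] is [M C0] composed with the invertible
    operator [(x, y) |-> (x + D y, y)], so it has the same range, an isomorphic
    kernel, and is left invertible when [M C0] is. Choosing [D] with
    [A D = P (V - C0)], where [V] is an isomorphism from [K] to [H] and [P] the
    projection on the range of [A], makes [C0 + A D] a finite rank perturbation
    of [V]. *)
Lemma finite_corank_completion : exists C : {linear K -> H}, [/\ Phi K H C,
  upper_semi_weyl (M C0) -> upper_semi_weyl (M C) &
  left_invertible (M C0) -> left_invertible (M C)].
Proof.
pose N := range A; have sN : subspace_set N by exact: subspace_range.
have [P [bP PN Po]] := projection sepH sN cA.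
have [V [V' [[bV _ VK _] [bV' _ V'K _]]]] := closed_iso sepH sepK
  (@subspace_setT _ K) closedT infK (@subspace_setT _ H) closedT infH.
have [||D [bD AD]] := douglas sepH (@complete_seq _ H) bA
    (T := P \o (V \- C0)) _ cA.
- apply/bounded_mapP; apply: bounded_map_comp; first exact/bounded_mapP.
  by apply: bounded_mapB; exact/bounded_mapP.
- by move=> _ [x _ <-]; exact: PN.
pose C : {linear K -> H} := C0 \+ (A \o D).
exists C.
pose E : {linear (H * K)%type -> (H * K)%type} :=
  pair_map (fst \+ (D \o snd)) snd.
pose E' : {linear (H * K)%type -> (H * K)%type} :=
  pair_map (fst \- (D \o snd)) snd.
have EK : cancel E E' by move=> [x y] /=; rewrite addrK.
have E'K : cancel E' E by move=> [x y] /=; rewrite subrK.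
have ME z : M C z = M C0 (E z).
  by rewrite /= /block_op /= linearD -addrA [A _ + C0 _]addrC.
have bE' : bounded_map E'.
  apply: bounded_map_pair (bounded_map_snd _ _).
  apply: bounded_mapB; first exact: bounded_map_fst.
  by apply: bounded_map_comp (bounded_map_snd _ _); exact/bounded_mapP.
have rangeE : range (M C) = range (M C0).
  apply/seteqP; split=> _ [z _ <-]; first by exists (E z) => //; rewrite -ME.
  by exists (E' z) => //; rewrite ME E'K.
have alphaE : alpha (M C) = alpha (M C0).
  apply: (dim_mod_iso EK E'K) => z.
    by rewrite -[X in X <-> _]/(M C z = 0) ME.
  split=> [->|h]; first by rewrite linear0.
  by rewrite -(EK z) h linear0.
split.
- split.
    apply/bounded_mapP; apply: bounded_mapD; first exact/bounded_mapP.
    by apply: bounded_map_comp; exact/bounded_mapP.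
  pose G : {linear K -> H} := (idfun \- P) \o (V \- C0).
  apply: (@finite_rank_perturbation _ _ _ V C G V') => //.
  + by move=> x; exact: VK.
  + by move=> x; exact: V'K.
  + have := fdim_image (idfun \- P : {linear H -> H}) fA.
    apply: fdimS => [_ [x _ <-]|_ [h Nh <-] /=]; first by exists ((V \- C0) x).
    by apply: (perp_id (W := N)); [exact: subB|exact: Po].
  + move=> x; rewrite /C /G /= AD /=.
    by rewrite !opprB [RHS]addrCA subrKC addrC.
- by rewrite /upper_semi_weyl /upper_semi_fredholm /ind /beta alphaE rangeE.
- move=> [S [bS SK]]; exists (E' \o S); split.
    by apply/bounded_mapP; apply: bounded_map_comp => //; exact/bounded_mapP.
  by move=> z; rewrite ME -[LHS]/(E' (S (M C0 (E z)))) SK EK.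
Qed.
End FiniteCorank.
End BlockOperators.

(** * The spectra of the completions *)

Section Shift.
Variable R : realType.

Lemma sub_scalar_block (H K : normedModType R[i]) (A : {linear H -> H})
    (B : {linear K -> K}) (C : {linear K -> H}) l :
  sub_scalar (block_op A B C : {linear (H * K)%type -> (H * K)%type}) l =1
  block_op (sub_scalar A l) (sub_scalar B l) C.
Proof.
by move=> [x y]; rewrite /= /block_op /=; congr pair; rewrite addrAC.
Qed.

Lemma bounded_sub_scalar (H : normedModType R[i]) (A : {linear H -> H}) l :
  bounded_op A -> bounded_op (sub_scalar A l).
Proof.
move=> /bounded_mapP bA; apply/bounded_mapP; apply: bounded_mapB => //.
by exists (nm l) => [|x]; [exact: nm_ge0|rewrite /= nmZ].
Qed.

Lemma eq_left_invertible (X Y : normedModType R[i]) (T T' : {linear X -> Y}) :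
  T =1 T' -> left_invertible T -> left_invertible T'.
Proof. by move=> TT [S [bS ST]]; exists S; split=> // x; rewrite -TT ST. Qed.

Lemma eq_upper_semi_weyl (X Y : normedModType R[i]) (T T' : {linear X -> Y}) :
  T =1 T' -> upper_semi_weyl T -> upper_semi_weyl T'.
Proof.
by move=> /funext TT; rewrite /upper_semi_weyl /upper_semi_fredholm /ind /alpha /beta TT.
Qed.
End Shift.

Lemma inf_dim_fdim (F : fieldType) (V : lmodType F) :
  infinite_dimensional V -> ~ fdim [set: V] [set 0].
Proof.
move=> iV /(dim_mod_finP (@subspace_setT _ V) (@subspace_set0 _ V)) => /(_ _).
by rewrite iV ltxx => /(_ (@subsetT _ _)).
Qed.

Section Completion.
Variables (R : realType) (H K : hilbertType R).
Hypotheses (sepH : separable_space H) (sepK : separable_space K).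
Hypotheses (infH : ~ fdim [set: H] [set 0]) (infK : ~ fdim [set: K] [set 0]).
Variables (A : {linear H -> H}) (B : {linear K -> K}).
Hypotheses (bA : bounded_op A) (bB : bounded_op B).

Local Notation M C := (block_op A B C : {linear (H * K)%type -> (H * K)%type}).

(** An upper semi-Fredholm [M C0] forces the range of [A] to be closed and its
    kernel to be finite dimensional; the construction of [C] depends on whether
    that range has finite codimension. *)
Lemma fredholm_completion C0 : bounded_op C0 -> ~ compact_op B ->
  upper_semi_fredholm (M C0) ->
  exists C : {linear K -> H}, [/\ Phi K H C,
    upper_semi_weyl (M C0) -> upper_semi_weyl (M C) &
    left_invertible (M C0) -> left_invertible (M C)].
Proof.
move=> bC0 nB uM; have [cA fA] := block_usf_left sepK bA bB bC0 uM.
have [fR|nR] := pselect (fdim [set: H] (range A)).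
  exact: finite_corank_completion.
have [C [PC wC lC]] := infinite_corank_completion sepH sepK infH infK bB cA fA nR nB.
exists C; split=> // -[S [bS SK]]; apply: lC.
pose j : {linear H -> (H * K)%type} := pair_map idfun \0.
exists (fst \o (S \o j)); split.
  apply/bounded_mapP; apply: bounded_map_comp (bounded_map_fst _ _) _.
  apply: bounded_map_comp; first exact/bounded_mapP.
  apply: bounded_map_pair; first exact: bounded_map_id.
  by exists 0 => // x; rewrite nm0 mul0r.
move=> x; rewrite /= (_ : (A x, 0) = block_op A B C0 (x, 0)) ?SK //.
by rewrite /block_op /= !linear0 addr0.
Qed.
End Completion.

Theorem theorem5 (R : realType) (H K : hilbertType R)
    (H_sep : separable_space H) (K_sep : separable_space K)
    (H_inf : infinite_dimensional H) (K_inf : infinite_dimensional K)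
    (A : {linear H -> H}) (B : {linear K -> K})
    (A_bounded : bounded_op A) (B_bounded : bounded_op B)
    (sigma : {linear (H * K)%type -> (H * K)%type} -> set R[i])
    (sigmaE : sigma = sigma_l \/ sigma = sigma_aw) :
  \bigcap_(C in Phi K H) sigma (block_op A B C) =
    (\bigcap_(C in bounded_ops K H) sigma (block_op A B C)) `|`
      [set l : R[i] | compact_op (sub_scalar B l)].
Proof.
have iH := inf_dim_fdim H_inf; have iK := inf_dim_fdim K_inf.
(* what the two spectra have in common, after the shift by l *)
have [P [PE Pusf Pcompl]] : exists P : {linear (H * K)%type -> (H * K)%type} -> Prop,
  [/\ forall C l, sigma (block_op A B C) l <->
        ~ P (block_op (sub_scalar A l) (sub_scalar B l) C),
      forall T, bounded_op T -> P T -> upper_semi_fredholm T &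
      forall l C0, bounded_op C0 -> ~ compact_op (sub_scalar B l) ->
        P (block_op (sub_scalar A l) (sub_scalar B l) C0) ->
        exists2 C, Phi K H C & P (block_op (sub_scalar A l) (sub_scalar B l) C)].
  have compl l C0 := @fredholm_completion _ _ _ H_sep K_sep iH iK _ _
    (bounded_sub_scalar l A_bounded) (bounded_sub_scalar l B_bounded) C0.
  have bM l C0 := bounded_block (bounded_sub_scalar l A_bounded)
    (bounded_sub_scalar l B_bounded) (C := C0).
  case: sigmaE => ->; [exists (@left_invertible _ _ _)|exists (@upper_semi_weyl _ _ _)].
  - split=> [C l|T|l C0 bC0 nB lC].
    + split; apply: contra_not; apply: eq_left_invertible => z;
        by rewrite sub_scalar_block.
    + exact: left_invertible_usf.
    + have [C [PC _ h]] := compl _ _ bC0 nB (left_invertible_usf (bM l C0 bC0) lC).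
      by exists C => //; exact: h.
  - split=> [C l|T _ []//|l C0 bC0 nB wC].
    + split; apply: contra_not; apply: eq_upper_semi_weyl => z;
        by rewrite sub_scalar_block.
    + by have [C [PC h _]] := compl _ _ bC0 nB wC.1; exists C => //; exact: h.
apply/seteqP; split=> l hl.
  have [cB|nB] := pselect (compact_op (sub_scalar B l)); [by right|left].
  move=> C0 bC0; apply/PE => PC0.
  by have [C PC] := Pcompl l C0 bC0 nB PC0; apply/PE; exact: hl.
move=> C PC; have bC : bounded_op C by case: PC.
case: hl => [hl|cB]; first exact: hl.
apply/PE => /Pusf; have bM := bounded_block (bounded_sub_scalar l A_bounded)
    (bounded_sub_scalar l B_bounded) bC.
move=> /(_ bM); apply: fredholm_compact_not_usf => //; exact: bounded_sub_scalar.
Qed.
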